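(* Every cooperative kinetically constrained lattice gas (KCLG) on $\mathbb{Z}^d$ is non-gradient.
   Context: A kinetically constrained lattice gas (KCLG) is a Markov process on $\Omega=\{0,1\}^{\mathbb{Z}^d}$ determined by rates (''constraints'') $c_{x,y}(\eta)\in\{0\}\cup[1,\infty)$ for each (undirected) nearest-neighbor edge $(x,y)$ of $\mathbb{Z}^d$ and $\eta\in\Omega$, with generator $\mathcal{L}f(\eta)=\sum_{(x,y)}c_{x,y}(\eta)(f(\eta^{x,y})-f(\eta))$, where $\eta^{x,y}$ is $\eta$ with the occupations at $x$ and $y$ exchanged. A site $x$ is empty if $\eta(x)=0$ and occupied if $\eta(x)=1$. The rates are assumed to satisfy: (1) translation invariance; (2) $c_{x,y}$ depends only on the configuration outside $x$ and $y$; (3) finite range: for some $R$, $c_{x,y}$ depends only on the occupation of sites in $x+[-R,R]^d$; (4) non-degeneracy: for every edge $(x,y)$ there are configurations $\eta,\eta'$ with $c_{x,y}(\eta)>0$ and $c_{x,y}(\eta')=0$; (5) for fixed $x,y$, $c_{x,y}(\eta)$ is a decreasing (non-increasing) function of $\eta$. Two configurations $\eta,\eta'$ are connected if there is a finite sequence $\eta_0=\eta,\dots,\eta_T=\eta'$ such that for each $t\in\{0,\dots,T-1\}$ there are neighbors $x_{t+1}\sim y_{t+1}$ with $\eta_{t+1}=\eta_t^{x_{t+1},y_{t+1}}$ and $c_{x_{t+1},y_{t+1}}(\eta_t)\ge1$. For $A\subseteq\mathbb{Z}^d$, $\eta_A$ is the configuration with $\eta_A(x)=0$ for $x\in A$ and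 $\eta_A(x)=1$ otherwise. A finite non-empty $A\subset\mathbb{Z}^d$ is a mobile cluster if (i) for all $z\in\mathbb{Z}^d$, $\eta_A$ is connected to $\eta_{z+A}$; and (ii) for every edge $(x,y)$ there is $z\in\mathbb{Z}^d$ with $c_{x,y}(\eta_{z+A})\ge1$. The KCLG is non-cooperative if there exists a mobile cluster, and cooperative otherwise. The current is $W_{x,x+e}(\eta)=(\eta(x)-\eta(x+e))\,c_{x,x+e}(\eta)$. The model is gradient if there is $n_0\in\mathbb{N}$ and, for all $1\le i\le d$ and $1\le n\le n_0$, a cylinder (local) function $h_{i,n}$ and a finitely supported function $p_{i,n}$ on sites with $\sum_xp_{i,n}(x)=0$, such that $W_{0,e_i}(\eta)=\sum_{n=1}^{n_0}\sum_{x}p_{i,n}(x)\,h_{i,n}(\tau_x\eta)$ for every $i$, where $(\tau_x\eta)(y)=\eta(x+y)$ and $e_1,\dots,e_d$ is the standard basis. The model is non-gradient if it is not gradient. *)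

(* Defs.v *)
From mathcomp Require Import all_boot all_order all_algebra finmap.
From mathcomp Require Import reals.

Set Implicit Arguments.
Unset Strict Implicit.
Unset Printing Implicit Defensive.

Import Order.TTheory GRing.Theory Num.Theory.
Local Open Scope fset_scope.
Local Open Scope ring_scope.

Notation lattice d := 'rV[int]_d (only parsing).

Definition std_basis d (i : 'I_d) : lattice d := delta_mx 0 i.

Definition neighbors d (x y : lattice d) : bool :=
  \sum_(i < d) `|x 0 i - y 0 i| == 1.

(* [true] is an occupied site (1), [false] an empty one (0). *)
Definition config (d : nat) := lattice d -> bool.

Definition exchange d (x y : lattice d) (eta : config d) : config d :=
  fun z => if z == x then eta y else if z == y then eta x else eta z.

Definition shift d (x : lattice d) (eta : config d) : config d :=
  fun y => eta (x + y).

Definition empty_on d (A : {pred lattice d}) : config d :=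
  fun x => x \notin A.

Definition translate d (z : lattice d) (A : {fset lattice d}) :
  {fset lattice d} := [fset z + a | a in A].

(* The Markov process is determined by its rates, so a KCLG is identified with
   them.  Edges are undirected, hence [rateC].  [rate] is a total function, but
   only its values at neighboring sites are meaningful: every condition is
   imposed on those only. *)
Record KCLG (R : realType) (d : nat) := {
  rate :> lattice d -> lattice d -> config d -> R;
  rateC : forall x y eta, neighbors x y -> rate x y eta = rate y x eta;
  rate_values : forall x y eta, neighbors x y ->
    rate x y eta = 0 \/ 1 <= rate x y eta;
  rate_translation : forall x y z eta, neighbors x y ->
    rate (z + x) (z + y) eta = rate x y (shift z eta);
  rate_outside : forall x y (eta eta' : config d), neighbors x y ->
    (forall z, z != x -> z != y -> eta z = eta' z) ->
    rate x y eta = rate x y eta';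
  rate_finite_range : exists r : nat,
    forall x y (eta eta' : config d), neighbors x y ->
    (forall z : lattice d,
      (forall i, `|z 0 i - x 0 i| <= r%:Z) -> eta z = eta' z) ->
    rate x y eta = rate x y eta';
  rate_nondegenerate : forall x y, neighbors x y ->
    (exists eta, 0 < rate x y eta) /\ (exists eta', rate x y eta' = 0);
  rate_decreasing : forall x y (eta eta' : config d), neighbors x y ->
    (forall z, (eta z <= eta' z)%N) -> rate x y eta' <= rate x y eta
}.

Definition connected R d (c : KCLG R d) (eta eta' : config d) : Prop :=
  exists (T : nat) (s : nat -> config d),
    [/\ s 0%N = eta, s T = eta' &
        forall t, (t < T)%N -> exists x y,
          [/\ neighbors x y, s t.+1 = exchange x y (s t)
            & 1 <= c x y (s t)]].

Definition mobile_cluster R d (c : KCLG R d) (A : {fset lattice d}) : Prop :=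
  [/\ A != fset0,
      forall z, connected c (empty_on (mem A)) (empty_on (mem (translate z A)))
    & forall x y, neighbors x y ->
        exists z, 1 <= c x y (empty_on (mem (translate z A)))].

Definition noncooperative R d (c : KCLG R d) : Prop :=
  exists A, mobile_cluster c A.

Definition cooperative R d (c : KCLG R d) : Prop := ~ noncooperative c.

(* The current across the bond from x to x + e. *)
Definition current R d (c : KCLG R d) (x e : lattice d) (eta : config d) : R :=
  ((eta x)%:R - (eta (x + e))%:R) * c x (x + e) eta.

Definition local_function (R : realType) d (h : config d -> R) : Prop :=
  exists L : {fset lattice d}, forall eta eta' : config d,
    (forall x, x \in L -> eta x = eta' x) -> h eta = h eta'.

Definition gradient R d (c : KCLG R d) : Prop :=
  exists (n0 : nat) (h : 'I_d -> 'I_n0 -> config d -> R)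
         (p : 'I_d -> 'I_n0 -> {fsfun lattice d -> R with 0}),
    [/\ forall i n, local_function (h i n),
        forall i n, \sum_(x <- finsupp (p i n)) p i n x = 0
      & forall i eta, current c 0 (std_basis i) eta =
          \sum_(n < n0) \sum_(x <- finsupp (p i n))
            p i n x * h i n (shift x eta)].

Definition nongradient R d (c : KCLG R d) : Prop := ~ gradient c.

(* Main.v *)
Require Import Defs.
From mathcomp Require Import all_boot all_order all_algebra finmap.
From mathcomp Require Import reals boolp zify ring.

(** In a gradient model the currents in direction [e_i] sum to zero over all
    bonds, for every configuration with finitely many vacancies.  So a vacancy
    that can move by [-e_i] forces one that can move by [+e_i]; as moves are
    reversible, vacancies that can move at all can drift in direction [+e_i]
    forever.  For a smallest such set of vacancies the range of the rates bounds
    the diameter, so by pigeonhole it reaches a translate of itself: this gives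
    a "bead" in each direction, and one may assume that it consists of [K]
    vacancies and moves by [K e_i].

    Passing through other sites, a bead of direction [i] preserves their order
    on each line, and shifts them back by the number of its vacancies on that
    line.  Beads placed at all positions [w] of a transversal l1-ball form an
    "arm" that shifts everything near its axis rigidly by [K e_i].  Together the
    arms transport the beads of one another in all directions: a bead too far
    from one axis is brought closer by an arm in a direction where it has a large
    coordinate.  The union of the arms is a "vehicle" that moves by [K e_i] for
    each [i].

    Finally, a "fleet" of vehicles, one in each residue class modulo [K], moves by
    [e_i]: this permutes the classes, and in dimension at least 2 the vehicles
    can be rearranged accordingly by moving around each other.  In dimension 1
    beads are used instead, and the last one passes through all the others. *)

Set Implicit Arguments.
Unset Strict Implicit.
Unset Printing Implicit Defensive.

Import Order.TTheory GRing.Theory Num.Theory.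
Local Open Scope fset_scope.
Local Open Scope ring_scope.

Notation vac A := (empty_on (mem A)).

(** * Lattice geometry *)

Section Lattice.
Variable d : nat.
Notation T := 'rV[int]_d.
Implicit Types (x y z u v : T) (A B C E F : {fset T}) (i j : 'I_d).

Definition l1 x : nat := (\sum_i `|x 0%R i|)%N.

(** Two sites lie on a common line in direction [i] exactly when these agree; zeroing the coordinate
    instead of dropping it avoids a change of dimension. *)
Definition proj i x : T := \row_j (if j == i then 0 else x 0 j).

Lemma in_translate z A x : (x \in translate z A) = (x - z \in A).
Proof.
apply/imfsetP/idP => [[a /= aA ->]|xA]; first by rewrite addrC addKr.
by exists (x - z); rewrite //= addrC subrK.
Qed.

Lemma translateD z z' A : translate (z + z') A = translate z (translate z' A).
Proof. by apply/fsetP => x; rewrite !in_translate opprD addrA. Qed.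

Lemma translate0 A : translate 0 A = A.
Proof. by apply/fsetP => x; rewrite in_translate subr0. Qed.

Lemma translateU z A B : translate z (A `|` B) = translate z A `|` translate z B.
Proof. by apply/fsetP => x; rewrite !(in_translate, inE). Qed.

Lemma card_translate z A : #|` translate z A| = #|` A|.
Proof. by rewrite card_imfset //= => x y /addrI. Qed.

Lemma std_basisE i j : std_basis i 0 j = (i == j)%:R.
Proof. by rewrite /std_basis mxE eqxx eq_sym. Qed.

Lemma std_basisME i j (m : int) : (std_basis i *~ m) 0 j = if i == j then m else 0.
Proof.
rewrite -scaler_int mxE std_basisE intz.
by case: eqP; rewrite ?mulr1 ?mulr0.
Qed.

Lemma std_basisMnE i j (m : nat) : (std_basis i *+ m) 0 j = if i == j then m%:Z else 0.
Proof. by rewrite pmulrn std_basisME. Qed.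

Lemma rvD x y i : (x + y) 0 i = x 0 i + y 0 i.
Proof. by rewrite mxE. Qed.
Lemma rvN x i : (- x) 0 i = - x 0 i.
Proof. by rewrite mxE. Qed.
Lemma rvB x y i : (x - y) 0 i = x 0 i - y 0 i.
Proof. by rewrite !mxE. Qed.
Lemma rv0 i : (0 : T) 0 i = 0.
Proof. by rewrite mxE. Qed.

Definition rvE := (rvD, rvN, rv0, std_basisME, std_basisMnE, std_basisE).

Lemma l1_coord x i : (`|x 0%R i| <= l1 x)%N.
Proof. by rewrite /l1 (bigD1 i) //= leq_addr. Qed.

Lemma l1D x y : (l1 (x + y) <= l1 x + l1 y)%N.
Proof.
rewrite /l1 -big_split /=; apply: leq_sum => i _; rewrite mxE.
move: (x 0 i) (y 0 i) => a b; lia.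
Qed.

Lemma l1N x : l1 (- x) = l1 x.
Proof. by apply: eq_bigr => i _; rewrite mxE abszN. Qed.

Lemma l1B x y : (l1 (x - y) <= l1 x + l1 y)%N.
Proof. by rewrite -(l1N y) l1D. Qed.

Lemma l1_proj i x : l1 x = (`|x 0%R i| + l1 (proj i x))%N.
Proof.
rewrite /l1 (bigD1 i) //= [in RHS](bigD1 i) //= mxE eqxx add0n; congr addn.
by apply: eq_bigr => j /negPf ji; rewrite mxE ji.
Qed.

Lemma projD i x y : proj i (x + y) = proj i x + proj i y.
Proof. by apply/rowP => j; rewrite !mxE; case: eqP. Qed.

Lemma projN i x : proj i (- x) = - proj i x.
Proof. by apply/rowP => j; rewrite !mxE; case: eqP. Qed.

Lemma proj_basis i (m : int) : proj i (std_basis i *~ m) = 0.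
Proof. by apply/rowP => j; rewrite !mxE std_basisME eq_sym; case: eqP. Qed.

Lemma proj_basis1 i : proj i (std_basis i) = 0.
Proof. by rewrite -[std_basis i]mulr1z proj_basis. Qed.

Lemma proj_basisn i (m : nat) : proj i (std_basis i *+ m) = 0.
Proof. by rewrite pmulrn proj_basis. Qed.

Lemma proj_eqP i x y : reflect (x = y + std_basis i *~ (x 0 i - y 0 i)) (proj i x == proj i y).
Proof.
apply: (iffP eqP) => [/rowP e|->]; last by rewrite projD proj_basis addr0.
apply/rowP => j; rewrite !rvE; case: eqVneq => [<-|ij]; first by rewrite addrC subrK.
by have := e j; rewrite !mxE eq_sym (negPf ij) addr0.
Qed.

Lemma l1_basis i (m : int) : l1 (std_basis i *~ m) = `|m|%N.
Proof.
rewrite (l1_proj i) proj_basis std_basisME eqxx /l1 big1 ?addn0 // => j _.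
by rewrite mxE.
Qed.

Lemma l1_basisn i (m : nat) : l1 (std_basis i *+ m) = m.
Proof. by rewrite pmulrn l1_basis. Qed.

Lemma fset_l1_bounded A : exists D, forall x, x \in A -> (l1 x <= D)%N.
Proof.
exists (\sum_(x <- A) l1 x)%N => x xA.
by rewrite (big_rem x) //= leq_addr.
Qed.

Lemma neighbors_basis x i : neighbors x (x + std_basis i).
Proof.
rewrite /neighbors (bigD1 i) //= big1 => [|j /negPf ji].
  by rewrite !rvE eqxx opprD addNKr // addr0; apply/eqP; lia.
by rewrite !rvE eq_sym ji addr0 subrr normr0.
Qed.

Lemma neighborsC x y : neighbors x y = neighbors y x.
Proof. by rewrite /neighbors; congr (_ == _); apply: eq_bigr => i _; rewrite distrC. Qed.

Lemma neighbors_translate z x y : neighbors (z + x) (z + y) = neighbors x y.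
Proof.
rewrite /neighbors; congr (_ == _); apply: eq_bigr => i _.
by rewrite !rvD opprD addrACA subrr add0r.
Qed.

Lemma neighbors_neq x y : neighbors x y -> x != y.
Proof.
apply: contraTneq => ->; rewrite /neighbors big1 // => i _.
by rewrite subrr normr0.
Qed.

Lemma neighborsP x y : neighbors x y ->
  exists i, y = x + std_basis i \/ x = y + std_basis i.
Proof.
move=> n; have nz : x - y != 0 by rewrite subr_eq0 neighbors_neq.
have [i xy] : exists i, x 0 i != y 0 i.
  by move/rV0Pn : nz => [i]; rewrite rvB subr_eq0; exists i.
exists i; move: n; rewrite /neighbors (bigD1 i) //=.
set S := \sum_(_ < _ | _) _ => /eqP e.
have S0 : 0 <= S by apply: sumr_ge0.
have {}S0 : S = 0 by lia.
have e0 j : j != i -> x 0 j = y 0 j.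
  move=> ji; have := psumr_eq0P _ S0 => /(_ (fun _ _ => normr_ge0 _) j ji) /eqP.
  by rewrite normr_eq0 subr_eq0 => /eqP.
have [e1|e1] : y 0 i = x 0 i + 1 \/ x 0 i = y 0 i + 1 by lia.
  left; apply/rowP => j; rewrite !rvE; case: eqVneq => [<-//|ij].
  by rewrite e0 ?addr0 // eq_sym.
right; apply/rowP => j; rewrite !rvE; case: eqVneq => [<-//|ij].
by rewrite e0 ?addr0 // eq_sym.
Qed.

Lemma in_bigU (I : finType) (F : I -> {fset T}) x :
  reflect (exists k, x \in F k) (x \in \big[fsetU/fset0]_k F k).
Proof.
apply: (iffP (bigfcupP _ _ _ _)) => [[i _ xi]|[i xi]]; exists i => //.
by rewrite mem_index_enum.
Qed.

End Lattice.

(* [lia] compares atoms syntactically, so terms [l1 x] that differ only in the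
   canonical structures inside [x] are first identified by [move:]; clearing the
   context keeps it fast. *)
Ltac l1_lia :=
  repeat match goal with H : is_true (leq ?a ?b) |- _ =>
    match constr:(leq a b) with context [l1 _] => move: H end end;
  repeat match goal with |- context [l1 ?x] => move: (l1 x) end;
  repeat match goal with |- context [absz ?x] => move: (absz x) end;
  clear; lia.

Ltac row_ring := apply/rowP => ?; rewrite ?(rvD, rvN, rv0); ring.

(** * Moves of finitely many vacancies *)

Section Hops.
Variables (R : realType) (d : nat) (c : KCLG R d).
Notation T := 'rV[int]_d.
Implicit Types (x y z u v : T) (A B C E F : {fset T}) (i j : 'I_d).

Lemma vacE A z : vac A z = (z \notin A).
Proof. by []. Qed.

(** States are sets of vacancies. Only exchanges of a vacancy with a particle are recorded, since
    the others change nothing; [D] restricts the displacements. *)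
Inductive hops (D : rel T) A : {fset T} -> Prop :=
| hops0 : hops D A A
| hopsS B x y : hops D A B -> x \in B -> y \notin B -> D x y ->
    neighbors x y -> 1 <= c x y (vac B) -> hops D A (y |` (B `\ x)).

Definition conn := hops (fun _ _ => true).
Definition drift i := hops (fun x y => y == x + std_basis i).

(** Rates decrease in the occupation, so additional vacancies never violate a constraint. *)
Lemma rate_mono x y A B : neighbors x y -> A `<=` B ->
  1 <= c x y (vac A) -> 1 <= c x y (vac B).
Proof.
move=> xy AB /le_trans; apply; apply: rate_decreasing => // z.
rewrite !vacE; have := fsubsetP AB z.
by case: (z \in A) => [->//|_]; case: (z \in B).
Qed.

Lemma rate_translate z x y A : neighbors x y ->
  c (z + x) (z + y) (vac (translate z A)) = c x y (vac A).
Proof.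
move=> xy; rewrite rate_translation //; congr (c _ _ _); apply/funext => u.
by rewrite /shift !vacE in_translate addrC addKr.
Qed.

(** The rate ignores the occupations of [x] and [y], so the reverse of a legal move is legal. *)
Lemma rate_swap x y A : neighbors x y -> x \in A -> y \notin A ->
  c y x (vac (y |` (A `\ x))) = c x y (vac A).
Proof.
move=> xy xA yA; rewrite rateC; last by rewrite neighborsC.
apply: rate_outside => // z /negPf zx /negPf zy.
by rewrite !vacE !inE zx zy.
Qed.

Lemma exchange_vac x y A : x \in A -> y \notin A ->
  exchange x y (vac A) = vac (y |` (A `\ x)).
Proof.
move=> xA yA; apply/funext => z; rewrite /exchange !vacE !inE.
have yx : y != x by apply: contraNneq yA => ->.
case: (eqVneq z x) => [->|zx]; first by rewrite (negPf yA) eq_sym (negPf yx).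
by case: (eqVneq z y) => // _; rewrite xA.
Qed.

Lemma conn_connected A B : conn A B -> connected c (vac A) (vac B).
Proof.
elim=> [|{}B x y _ [n [s [s0 sn sP]]] xB yB _ xy cB].
  by exists 0%N, (fun=> vac A).
exists n.+1, (fun t => if (t <= n)%N then s t else vac (y |` (B `\ x))).
split; rewrite ?ltnn // => t tn.
rewrite (ltnS t n) in tn; rewrite tn; case: (ltnP t n) => [/sP //|nt].
have -> : t = n by lia.
by exists x, y; split => //; rewrite sn // exchange_vac.
Qed.

Lemma hops_trans D A B C : hops D A B -> hops D B C -> hops D A C.
Proof. by move=> AB; elim=> // {}C x y _ AC xC yC Dxy xy cC; apply: hopsS. Qed.

Lemma conn_sym A B : conn A B -> conn B A.
Proof.
elim=> [|{}B x y _ BA xB yB _ xy cB]; first exact: hops0.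
apply: hops_trans BA.
have yx : y != x by apply: contraNneq yB => ->.
have -> : B = x |` ((y |` (B `\ x)) `\ y).
  apply/fsetP => z; rewrite !inE; case: (eqVneq z x) => [->|zx] //=.
  by case: (eqVneq z y) => [->|//]; rewrite (negPf yB).
rewrite {1}(_ : x |` _ = B); last first.
  apply/fsetP => z; rewrite !inE; case: (eqVneq z x) => [->|zx] //=.
  by case: (eqVneq z y) => [->|//]; rewrite (negPf yB).
apply: hopsS; first exact: hops0.
- by rewrite !inE eqxx.
- by rewrite !inE eqxx eq_sym (negPf yx).
- by [].
- by rewrite neighborsC.
- by rewrite rate_swap.
Qed.

Lemma drift_conn i A B : drift i A B -> conn A B.
Proof. by elim=> [|{}B x y *]; [apply: hops0 | apply: hopsS]. Qed.

Lemma hops_translate (D : rel T) z A B : (forall x y, D x y -> D (z + x) (z + y)) ->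
  hops D A B -> hops D (translate z A) (translate z B).
Proof.
move=> Dz; elim=> [|{}B x y _ IH xB yB Dxy xy cB]; first exact: hops0.
have -> : translate z (y |` (B `\ x)) = (z + y) |` (translate z B `\ (z + x)).
  apply/fsetP => u; rewrite !(in_translate, inE).
  by rewrite !subr_eq ![_ + z]addrC.
apply: hopsS => //; rewrite ?in_translate ?[z + _]addrC ?addrK //.
- by rewrite ![_ + z]addrC; exact: Dz.
- by rewrite ![_ + z]addrC neighbors_translate.
- by rewrite ![_ + z]addrC rate_translate.
Qed.

Lemma conn_translate z A B : conn A B -> conn (translate z A) (translate z B).
Proof. exact: hops_translate. Qed.

Lemma drift_translate i z A B : drift i A B -> drift i (translate z A) (translate z B).
Proof. by apply: hops_translate => x y /eqP ->; rewrite addrA. Qed.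

(** A finite path visits a bounded region. Vacancies of [E] outside it are never touched, and by
    [rate_mono] they do not invalidate any move. *)
Lemma hops_local D A B : hops D A B ->
  exists n, forall E, (forall x, x \in E -> (n < l1 x)%N) -> hops D (A `|` E) (B `|` E).
Proof.
elim=> [|{}B x y _ [n IH] xB yB Dxy xy cB]; first by exists 0%N => E _; exact: hops0.
exists (n + l1 x + l1 y)%N => E farE.
have notE z : (l1 z <= n + l1 x + l1 y)%N -> z \notin E.
  by move=> zn; apply/negP => /farE; rewrite ltnNge zn.
have -> : (y |` (B `\ x)) `|` E = y |` ((B `|` E) `\ x).
  apply/fsetP => z; rewrite !inE.
  case: (eqVneq z x) => [->|zx] /=; last by rewrite orbA.
  by rewrite (negbTE (notE x _)) ?orbF //; lia.
apply: hopsS => //.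
- by apply: IH => z /farE; lia.
- by rewrite inE xB.
- by rewrite inE negb_or yB notE //; lia.
- by apply: rate_mono cB => //; exact: fsubsetUl.
Qed.

Lemma hops_local_translate (D : rel T) A B : (forall z x y, D x y -> D (z + x) (z + y)) ->
  hops D A B -> exists n, forall z E, (forall x, x \in E -> (n < l1 (x - z))%N) ->
    hops D (translate z A `|` E) (translate z B `|` E).
Proof.
move=> Dz /hops_local[n AB]; exists n => z E farE.
have := hops_translate (Dz z) (AB (translate (- z) E) _).
rewrite !translateU -translateD subrr translate0; apply => x.
by rewrite in_translate opprK => /farE; rewrite addrK.
Qed.

End Hops.

(** * Transport by drifting vacancies *)

Section Sweep.
Variables (R : realType) (d : nat) (c : KCLG R d).
Notation T := 'rV[int]_d.
Implicit Types (x y z u v : T) (A B C E F : {fset T}) (i j : 'I_d).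

Definition cnt (P : pred T) C := #|` [fset a in C | P a]|.

(** For [z] outside [C], this numbers the sites outside [C] on the line of [z] consecutively and in
    order; below all of [C] the number is the coordinate itself. *)
Definition rank i C z : int :=
  z 0 i - (cnt (fun a => (proj i a == proj i z) && (a 0 i < z 0 i)) C)%:Z.

Lemma eq_cnt (P Q : pred T) C : {in C, P =1 Q} -> cnt P C = cnt Q C.
Proof.
move=> PQ; congr #|` _|; apply/fsetP => a; rewrite !inE /=.
by case: (boolP (a \in C)) => //= /PQ ->.
Qed.

Lemma cnt_swap (P : pred T) C x y : x \in C -> y \notin C ->
  (cnt P (y |` (C `\ x)) + P x = cnt P C + P y)%N.
Proof.
move=> xC yC; rewrite /cnt.
set S := [fset a in C `\ x | P a].
have xS : x \notin S by rewrite !inE eqxx.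
have yS : y \notin S by rewrite !inE (negPf yC) !andbF.
have -> : [fset a in y |` (C `\ x) | P a] = if P y then y |` S else S.
  apply/fsetP => a; case: ifP => Py; rewrite !inE /=.
    by case: eqVneq => [->|//]; rewrite Py.
  by case: eqVneq => [->|//]; rewrite Py !andbF.
have -> : [fset a in C | P a] = if P x then x |` S else S.
  apply/fsetP => a; case: ifP => Px; rewrite !inE /=.
    by case: eqVneq => [->|//]; rewrite Px xC.
  by case: eqVneq => [->|//]; rewrite Px !andbF.
by case: (P y); case: (P x); rewrite ?cardfsU1 ?xS ?yS //=; lia.
Qed.

Lemma cnt_line_drift i z A C : drift c i A C ->
  cnt (fun a => proj i a == z) C = cnt (fun a => proj i a == z) A.
Proof.
elim=> // {}C x y _ <- xC yC /eqP ye _ _.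
have := cnt_swap (fun a => proj i a == z) xC yC.
have -> : proj i y = proj i x by rewrite ye projD proj_basis1 addr0.
by move/addIn.
Qed.

(** The hop changes the count below [z] only if [x] is below [z] and [x + e_i] is not, on the same
    line; this forces [z = x + e_i]. *)
Lemma rank_step i C x z : x \in C -> x + std_basis i \notin C -> z \notin C ->
  z != x + std_basis i ->
  rank i ((x + std_basis i) |` (C `\ x)) z = rank i C z.
Proof.
set y := x + _ => xC yC zC zy; rewrite /rank; congr (_ - Posz _).
set P := fun a : T => _.
apply: (@addIn (P x)); rewrite cnt_swap //; congr (_ + nat_of_bool _)%N.
rewrite {}/P {1}/y projD proj_basis1 addr0; case: proj_eqP => //= e.
have zx : z 0 i != x 0 i.
  by apply: contraNneq zC => zx; rewrite [z](_ : _ = x) // e zx subrr addr0.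
have : z 0 i != x 0 i + 1.
  by apply: contraNneq zy => zx'; rewrite /y e zx' opprD addrA subrr add0r mulrN1z subrK eqxx.
rewrite /y !rvE eqxx; move: zx; move: (z 0 i) (x 0 i) => a b; lia.
Qed.

(** The content of [x + e_i] is displaced to [x] by the hop and keeps its rank. *)
Lemma rank_step_eq i C x : x \in C -> x + std_basis i \notin C ->
  rank i ((x + std_basis i) |` (C `\ x)) x = rank i C (x + std_basis i).
Proof.
set y := x + _ => xC yC; rewrite /rank.
have yi : y 0 i = x 0 i + 1 by rewrite /y !rvE eqxx.
have py : proj i y = proj i x by rewrite /y projD proj_basis1 addr0.
have := cnt_swap (fun a => (proj i a == proj i x) && (a 0 i < x 0 i)) xC yC.
rewrite ltxx andbF yi andbC [_ < x 0 i]ltNge lerDl ler01 /= !addn0 => ->.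
rewrite py; set P := fun a : T => _; set Q := fun a : T => _.
have -> : cnt Q C = (cnt P C).+1.
  rewrite /cnt; have -> : [fset a in C | Q a] = x |` [fset a in C | P a].
    apply/fsetP => a; rewrite !inE /= /P /Q.
    case: (eqVneq a x) => [->|ax] /=.
      by rewrite xC eqxx /= ltrDl.
    case: (a \in C) => //=; case: proj_eqP => //= e.
    have : a 0 i != x 0 i.
      by apply: contraNneq ax => aix; rewrite e aix subrr addr0.
    by move: (a 0 i) (x 0 i) => m n; lia.
  by rewrite cardfsU1 !inE /P ltxx !andbF.
by move: (cnt _ _) (x 0 i) => m n; lia.
Qed.

(* Drifting vacancies leave the order of the other sites on each line
   unchanged, so the rank of such a site among the others determines where the
   occupation found at it comes from. *)
Lemma drift_transport i C C' : drift c i C C' -> forall E E',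
  (forall z, z \in E -> z \notin C) -> (forall z, z \in E' -> z \notin C') ->
  (forall z y, z \notin C' -> y \notin C -> proj i z = proj i y ->
    rank i C' z = rank i C y -> (z \in E') = (y \in E)) ->
  conn c (C `|` E) (C' `|` E').
Proof.
elim=> [|{}C' x y Cd IH xC yC /eqP ye xy cC] E E' EC EC' EE'.
  have -> : E' = E; last exact: hops0.
  apply/fsetP => z; case: (boolP (z \in C)) => [zC|zC]; last exact: EE'.
  by rewrite (contraTF (@EC z)) ?(contraTF (@EC' z)) ?zC.
subst y; set y := x + _ in yC xy cC EC' EE' *.
have yx : y != x by apply: contraNneq yC => ->.
have yE' : y \notin E' by apply/negP => /EC'; rewrite !inE eqxx.
have pyx : proj i y = proj i x by rewrite /y projD proj_basis1 addr0.
(* [E1] is [E'] before the last hop: a vacancy of [E'] found at [x] afterwards was at [y]. *)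
pose E1 := if x \in E' then y |` (E' `\ x) else E'.
have inE1 z : z != x -> z != y -> (z \in E1) = (z \in E').
  by rewrite /E1 => /negPf zx /negPf zy; case: ifP => // _; rewrite !inE zx zy.
have yE1 : (y \in E1) = (x \in E').
  by rewrite /E1; case: ifP => // xE'; rewrite ?inE ?eqxx // (negPf yE').
have xE1 : x \notin E1.
  by rewrite /E1; case: ifP => [_|->//]; rewrite !inE eqxx eq_sym (negPf yx).
have {}IH : conn c (C `|` E) (C' `|` E1).
  apply: IH => // [z zE1|z w zC' wC pzw].
    case: (eqVneq z y) => [->//|zy].
    have zx : z != x by apply: contraTneq zE1 => ->.
    by move: zE1; rewrite inE1 // => /EC'; rewrite !inE (negPf zx) (negPf zy).
  have zx : z != x by apply: contraNneq zC' => ->.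
  case: (eqVneq z y) => [zy|zy].
    rewrite zy yE1 -rank_step_eq // => r; apply: EE' => //; last by rewrite -pyx -zy.
    by rewrite !inE eqxx eq_sym (negPf yx).
  rewrite inE1 // -(rank_step (x := x)) // => r; apply: EE' => //.
  by rewrite !inE (negPf zx) (negPf zy).
(* If [x] is in [E'], both ends of the bond are vacant before the hop and the union does not change;
   otherwise the hop is really carried out. *)
apply: hops_trans IH _; case: (boolP (x \in E')) => xE'.
  have -> : C' `|` E1 = (y |` (C' `\ x)) `|` E'; last exact: hops0.
  apply/fsetP => z; rewrite !inE.
  case: (eqVneq z x) => [->|zx]; first by rewrite xC xE' !orbT.
  case: (eqVneq z y) => [->|zy]; first by rewrite yE1 xE' !orbT.
  by rewrite inE1.
have -> : E1 = E' by rewrite /E1 (negPf xE').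
have -> : (y |` (C' `\ x)) `|` E' = y |` ((C' `|` E') `\ x).
  by apply/fsetP => z; rewrite !inE; case: (eqVneq z x) => [->|_] /=;
    rewrite ?(negPf xE') ?orbF ?orbA.
apply: hopsS => //; first exact: hops0.
- by rewrite inE xC.
- by rewrite inE negb_or yC.
- by apply: rate_mono cC => //; exact: fsubsetUl.
Qed.

(** On each line through [B], all [n] vacancies of [C] pass from below to above; since the order of
    the other sites is preserved, the contents move back by [n]. Lines through [F] carry no vacancy
    of [C], so nothing moves there. *)
Lemma sweep i C C' (n : nat) B F : drift c i C C' -> (0 < n)%N ->
  (forall b, b \in B -> cnt (fun a => proj i a == proj i b) C = n) ->
  (forall b a, b \in B -> a \in C -> proj i a = proj i b -> a 0 i < b 0 i) ->
  (forall b a, b \in B -> a \in C' -> proj i a = proj i b -> b 0 i + n%:Z < a 0 i) ->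
  (forall f a, f \in F -> a \in C -> proj i a != proj i f) ->
  conn c (C `|` (translate (std_basis i *+ n) B `|` F)) (C' `|` (B `|` F)).
Proof.
move=> CC' n0 nB BC BC' FC.
have pB b : proj i (b - std_basis i *+ n) = proj i b.
  by rewrite projD projN proj_basisn subr0.
have FC' f a : f \in F -> a \in C' -> proj i a != proj i f.
  move=> fF aC'; apply/negP => /eqP e.
  have : cnt (fun a => proj i a == proj i f) C' = 0%N.
    rewrite (cnt_line_drift _ CC'); apply/eqP; rewrite cardfs_eq0.
    apply/eqP/fsetP => u; rewrite !inE /=; apply/negP => /andP[uC].
    exact/negP/FC.
  move/eqP; rewrite cardfs_eq0 => /eqP/fsetP/(_ a).
  by rewrite !inE /= aC' e eqxx.
apply: (drift_transport CC') => [z|z|z y zC' yC pzy rzy].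
- rewrite in_fsetU in_translate => /orP[zB|zF]; apply/negP => zC.
    have := BC _ _ zB zC (esym (pB z)).
    by rewrite rvD rvN std_basisMnE eqxx; move: (z 0 i) => m; lia.
  by have := FC _ _ zF zC; rewrite eqxx.
- rewrite in_fsetU => /orP[zB|zF]; apply/negP => zC.
    by have := BC' _ _ zB zC erefl; move: (z 0 i) => m; lia.
  by have := FC' _ _ zF zC; rewrite eqxx.
rewrite !in_fsetU in_translate.
pose L := cnt (fun a => proj i a == proj i z) C.
have L' : cnt (fun a => proj i a == proj i z) C' = L by exact: cnt_line_drift.
pose Pz : pred T := fun a => (proj i a == proj i z) && (a 0 i < z 0 i).
have cnt_le A : (cnt Pz A <= cnt (fun a => proj i a == proj i z) A)%N.
  by apply/fsubset_leq_card/fsubsetP => a; rewrite !inE /= => /and3P[-> ->].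
(* On a line without vacancies of [C] ranks are coordinates, so [z = y]. *)
case: (posnP L) => [L0|Lpos].
  have zy : z = y.
    have e : z 0 i = y 0 i.
      move: rzy; rewrite /rank.
      have /eqP : cnt Pz C' == 0%N.
        by rewrite -leqn0 (leq_trans (cnt_le _)) // L' L0.
      rewrite /Pz => ->; rewrite (_ : cnt _ C = 0%N) ?subr0 //.
      apply/eqP; rewrite -leqn0; apply: (@leq_trans L); last by rewrite L0.
      apply/fsubset_leq_card/fsubsetP => a.
      by rewrite !inE /= pzy => /and3P[-> ->].
    by move/eqP/proj_eqP : pzy; rewrite e subrr addr0.
  rewrite -zy; congr orb.
  have zB : z \notin B by apply/negP => /nB; rewrite -/L L0 => e; rewrite -e in n0.
  rewrite (negPf zB); apply/esym/negP => /nB; rewrite pB -/L L0 => e.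
  by rewrite -e in n0.
have notF w : proj i w = proj i z -> w \notin F.
  move=> pw; apply/negP => wF.
  move: Lpos; rewrite cardfs_gt0 => /fset0Pn[a]; rewrite !inE /= => /andP[aC /eqP pa].
  by have := FC _ _ wF aC; rewrite pa pw eqxx.
rewrite (negPf (notF z erefl)) (negPf (notF y (esym pzy))) !orbF.
apply/idP/idP => [zB|yB].
  have Ln : L = n by exact: nB.
  have : rank i C' z = z 0 i.
    rewrite /rank (_ : cnt _ _ = 0%N) ?subr0 //; apply/eqP; rewrite cardfs_eq0.
    apply/eqP/fsetP => a; rewrite !inE /=; apply/negP => /and3P[aC' /eqP pa].
    by have := BC' _ _ zB aC' pa; move: (a 0 i) (z 0 i) => k m; lia.
  rewrite rzy {1}/rank => e.
  have zley : z 0 i <= y 0 i by rewrite -e lerBlDr lerDl.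
  have : cnt (fun a => (proj i a == proj i y) && (a 0 i < y 0 i)) C = n.
    rewrite -Ln /L pzy; apply: eq_cnt => a aC; rewrite /=; case: eqP => //= pa.
    by apply: lt_le_trans zley; apply: BC => //; rewrite pzy.
  move=> cn; rewrite cn in e.
  have -> : y - std_basis i *+ n = z; last by [].
  move/eqP: (esym pzy) => /proj_eqP ->; rewrite -e opprB addrCA subrr addr0.
  by rewrite -pmulrn addrK.
set b := y - _ in yB.
have pbz : proj i b = proj i z by rewrite pB.
have bi : b 0 i = y 0 i - n%:Z by rewrite rvD rvN std_basisMnE eqxx.
have Ln : L = n by rewrite /L -pbz; exact: nB.
have ry : rank i C y = b 0 i.
  rewrite /rank bi; congr (_ - Posz _); rewrite -Ln /L -pzy.
  apply: eq_cnt => a aC; rewrite /=; case: eqP => //= pa.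
  have := BC _ _ yB aC; rewrite pa pbz => /(_ erefl); rewrite bi.
  by move: (a 0 i) (y 0 i) => k m; lia.
(* At most [n] vacancies of [C'] lie below [z], so [z] is at most [n] beyond [b], where the margin
   in [BC'] excludes every such vacancy. *)
have cz := cnt_le C'; rewrite L' Ln /Pz in cz.
have : rank i C' z = z 0 i.
  rewrite /rank (_ : cnt _ _ = 0%N) ?subr0 //; apply/eqP; rewrite cardfs_eq0.
  apply/eqP/fsetP => a; rewrite !inE /=; apply/negP => /and3P[aC' /eqP pa az].
  have := BC' _ _ yB aC'; rewrite pa pbz => /(_ erefl).
  move: rzy; rewrite ry /rank; move: cz az.
  by move: (cnt _ _) => k; move: (a 0 i) (z 0 i) (b 0 i) => m p q; lia.
rewrite rzy ry => e; have -> : z = b; last by [].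
by move/eqP/proj_eqP : pbz => ->; rewrite e subrr addr0.
Qed.

End Sweep.

(** * Drifting clusters in gradient models *)

Section Gradient.
Variables (R : realType) (d : nat) (c : KCLG R d).
Notation T := 'rV[int]_d.
Implicit Types (x y z u v : T) (A B C E F : {fset T}) (i j : 'I_d).

Lemma sum_shift_fset (f : T -> R) (S I : {fset T}) x :
  (forall u, u \notin S -> f u = 0) -> (forall u, u \in S -> u - x \in I) ->
  \sum_(y <- I) f (x + y) = \sum_(u <- S) f u.
Proof.
move=> f0 SI.
have -> : \sum_(y <- I) f (x + y) = \sum_(u <- translate x I) f u.
  by rewrite big_imfset //= => u v _ _ /addrI.
apply/esym/big_fset_incl => [|u _ /f0 //].
by apply/fsubsetP => u uS; rewrite in_translate SI.
Qed.

Lemma current_shift y i eta :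
  current c y (std_basis i) eta = current c 0 (std_basis i) (shift y eta).
Proof.
rewrite /current -rate_translation ?neighbors_basis // /shift addr0 add0r.
by [].
Qed.

(** Since the weights sum to zero, the value of [h] at the full configuration may be subtracted,
    which makes the summands finitely supported. Over a large enough set of bonds, each weight is
    then multiplied by the same total, and the weights cancel. [J] prescribes bonds to be
    included. *)
Lemma zero_current i A (J : {fset T}) : gradient c ->
  exists2 I, J `<=` I & \sum_(y <- I) current c y (std_basis i) (vac A) = 0.
Proof.
case=> n0 [h [p [/(_ i) /choice[L hL] /(_ i) p0 hp]]].
pose full : config d := fun=> true.
(* For shifts outside [S n], the support of [h i n] sees no vacancy. *)
pose S n := [fset a - l | a in A, l in L n].
pose f n u := h i n (shift u (vac A)) - h i n full.
have f0 n u : u \notin S n -> f n u = 0.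
  move=> uS; apply/eqP; rewrite subr_eq0; apply/eqP/hL => l lL.
  rewrite /shift vacE; apply: contraNN uS => ulA.
  by apply/imfset2P; exists (u + l) => //; exists l; rewrite ?addrK.
(* Large enough that for every [x] the inner sum covers all of [S n]. *)
pose I := (J `|` \bigcup_(n in 'I_n0) \bigcup_(x <- finsupp (p i n)) translate (- x)%R (S n))%fset.
exists I; first exact: fsubsetUl.
have curE y : current c y (std_basis i) (vac A) =
    \sum_(n < n0) \sum_(x <- finsupp (p i n)) p i n x * f n (x + y).
  rewrite current_shift hp; apply: eq_bigr => n _.
  transitivity (\sum_(x <- finsupp (p i n)) (p i n x * f n (x + y) + p i n x * h i n full)).
    apply: eq_bigr => x _; rewrite -mulrDr subrK; congr (_ * h i n _).
    by apply/funext => z; rewrite /shift; congr (vac A _); rewrite addrCA addrA.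
  by rewrite big_split /= -mulr_suml p0 mul0r addr0.
under eq_bigr do rewrite curE.
rewrite exchange_big big1 //= => n _; rewrite exchange_big /=.
transitivity (\sum_(x <- finsupp (p i n)) p i n x * \sum_(u <- S n) f n u).
  rewrite big_seq [RHS]big_seq; apply: eq_bigr => x xp.
  rewrite -mulr_sumr (sum_shift_fset (@f0 n)) // => u uS.
  rewrite in_fsetU; apply/orP; right; apply/bigfcupP; exists n => //.
    by rewrite mem_index_enum.
  by apply/bigfcupP; exists x; rewrite ?xp // in_translate opprK subrK.
by rewrite -mulr_suml p0 mul0r.
Qed.

Definition right_hop i A x :=
  [&& x \in A, x + std_basis i \notin A & 1 <= c x (x + std_basis i) (vac A)].

(* The currents through the bonds in a given direction cancel, so a vacancy
   that can move to the left forces one that can move to the right. *)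
Lemma left_right_hop i A x : gradient c -> x + std_basis i \in A -> x \notin A ->
  1 <= c x (x + std_basis i) (vac A) -> exists y, right_hop i A y.
Proof.
move=> gc xeA xA cA; apply: contrapT => noR.
have [I xI] := zero_current i A [fset x] gc.
have {}xI : x \in I by apply: (fsubsetP xI); rewrite inE.
rewrite (big_rem x) //= /current !vacE xeA xA /= subr0 mul1r.
(* The term of [x] is at least 1, and without right hops all other terms are nonnegative. *)
apply/eqP; rewrite gt_eqF // ltr_wpDr ?(lt_le_trans _ cA) //.
apply: sumr_ge0 => y _; rewrite !vacE.
have := rate_values c (vac A) (neighbors_basis y i).
case: (boolP (y \in A)) => yA; case: (boolP (_ \in A)) => yeA /=;
  rewrite ?subrr ?mul0r ?subr0 ?mul1r //.
  case=> [->|cy]; first by rewrite mulr0.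
  by case: noR; exists y; rewrite /right_hop yA yeA.
by case=> [->|/(le_trans ler01)].
Qed.

(** A canonical choice of a hop, so that iterating [next] yields a trajectory; the default 0 occurs
    only when no right hop exists. *)
Definition hop_site i A := head 0 [seq x <- A | right_hop i A x].
Definition next i A := (hop_site i A + std_basis i) |` (A `\ hop_site i A).

Lemma hop_siteP i A : (exists x, right_hop i A x) -> right_hop i A (hop_site i A).
Proof.
case=> x hx; rewrite /hop_site.
have : x \in [seq x <- A | right_hop i A x] by rewrite mem_filter hx; case/and3P: hx.
case e: [seq _ <- _ | _] => [//|y s] _ /=.
have : y \in [seq x <- A | right_hop i A x] by rewrite e inE eqxx.
by rewrite mem_filter => /andP[].
Qed.

(** The vacancy that has just moved right can move back left, so [left_right_hop] provides another
    right hop. *)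
Lemma next_hop i A : gradient c -> (exists x, right_hop i A x) ->
  exists x, right_hop i (next i A) x.
Proof.
move=> gc /hop_siteP; rewrite /next; move: (hop_site i A) => x /and3P[xA xeA cA].
have nx := neighbors_basis x i.
apply: (left_right_hop (x := x)) => //.
- by rewrite !inE eqxx.
- by rewrite !inE eqxx orbF; exact: neighbors_neq.
- by rewrite rateC // rate_swap.
Qed.

Lemma next_drift i A : (exists x, right_hop i A x) -> drift c i A (next i A).
Proof.
move=> /hop_siteP /and3P[xA xeA cA]; apply: hopsS => //; first exact: hops0.
exact: neighbors_basis.
Qed.

Lemma card_next i A : (exists x, right_hop i A x) -> #|` next i A| = #|` A|.
Proof.
move=> /hop_siteP /and3P[xA xeA _].
by rewrite cardfsU1 !inE (negPf xeA) andbF [RHS](cardfsD1 (hop_site i A)) xA.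
Qed.

(** The sum of the positions measures progress; it later identifies the displacement between two
    translates. *)
Lemma sum_next i A : (exists x, right_hop i A x) ->
  \sum_(a <- next i A) a = \sum_(a <- A) a + std_basis i.
Proof.
move=> /hop_siteP /and3P[xA xeA _].
rewrite big_fsetU1 ?inE ?(negPf xeA) ?andbF //= (big_fsetD1 _ xA) /=.
by rewrite addrAC.
Qed.

Lemma sum_translate z A : \sum_(a <- translate z A) a = \sum_(a <- A) a + z *+ #|` A|.
Proof.
rewrite big_imfset /= => [|u v _ _ /addrI //].
rewrite big_split /= addrC; congr (_ + _).
by rewrite big_const_seq count_predT iter_addr_0.
Qed.

(** * Smallest hopping clusters and their recurrence *)

Definition box (r : nat) : {fset T} :=
  [fset (\row_j ((f j : nat)%:Z - r%:Z) : T) | f : {ffun 'I_d -> 'I_(r + r).+1} in predT].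

Lemma in_box r x : (forall j, `|x 0 j| <= r%:Z) -> x \in box r.
Proof.
move=> xr; apply/imfsetP; exists [ffun j => inord (absz (x 0 j + r%:Z))] => //=.
apply/rowP => j; rewrite mxE ffunE.
by have := xr j; move: (x 0 j) => m mr; rewrite inordK; lia.
Qed.

(** By non-degeneracy and monotonicity the hop is allowed when everything is empty. By finite range
    an empty box suffices, and the target may be occupied because the rate ignores it. *)
Lemma right_hop_exists i : exists A x, right_hop i A x.
Proof.
have nx := neighbors_basis (0 : T) i.
have [r hr] := rate_finite_range c.
have [[eta c0] _] := rate_nondegenerate c nx.
pose free : config d := fun=> false.
have c1 : 1 <= c 0 (0 + std_basis i) free.
  have := rate_decreasing c (eta := free) (eta' := eta) nx (fun=> leq0n _).
  by have [->|//] := rate_values c free nx; rewrite leNgt c0.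
exists (0 |` (box r `\ (0 + std_basis i))), 0; apply/and3P; split.
- by rewrite !inE eqxx.
- by rewrite !inE eqxx; have := neighbors_neq nx; rewrite eq_sym => /negPf ->.
rewrite (le_trans c1) // le_eqVlt; apply/orP; left; apply/eqP.
transitivity (c 0 (0 + std_basis i) (vac (box r))).
  apply: hr => // z zr; rewrite vacE in_box // => j.
  by have := zr j; rewrite rv0 subr0.
apply: rate_outside => // z z0 ze.
by rewrite !vacE !inE (negPf z0) (negPf ze).
Qed.

Lemma drifting_cluster i : gradient c -> exists A (k : nat),
  [/\ (0 < #|` A|)%N, (0 < k)%N, drift c i A (translate (std_basis i *+ k) A)
    & exists x, 1 <= c x (x + std_basis i) (vac A)].
Proof.
move=> gc.
pose P n := `[< exists A, (exists x, right_hop i A x) /\ #|` A| = n >].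
have exP : exists n, P n.
  by have [A hA] := right_hop_exists i; exists #|` A|; apply/asboolP; exists A.
case: (ex_minnP exP) => N /asboolP[A0 [h0 cA0]] minN.
pose A n := iter n (next i) A0.
have hA n : exists x, right_hop i (A n) x by elim: n => //= n; exact: next_hop.
have cA n : #|` A n| = N by elim: n => //= n IH; rewrite card_next.
have dA m n : drift c i (A m) (A (n + m)%N).
  elim: n => [|n IH]; first exact: hops0.
  by apply: hops_trans IH _; exact: next_drift.
have sA m n : \sum_(a <- A (n + m)%N) a = \sum_(a <- A m) a + std_basis i *+ n.
  elim: n => [|n IH]; first by rewrite mulr0n addr0.
  by rewrite addSn sum_next // IH mulrS -addrA [_ + std_basis i]addrC.
have [r hr] := rate_finite_range c.
pose X n := hop_site i (A n).
have Abox n : translate (- X n) (A n) `<=` box r.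
  have [xA xeA cx] := and3P (hop_siteP (hA n)); rewrite -/(X n) in xA xeA cx.
  pose A' := [fset a in A n | [forall j, `|a 0 j - X n 0 j| <= r%:Z]].
  have A'A : A' `<=` A n by apply/fsubsetP => a; rewrite !inE => /andP[].
  have h' : right_hop i A' (X n).
    apply/and3P; split.
    - rewrite !inE xA /=; apply/forallP => j; rewrite subrr normr0; exact: isT.
    - by apply: contra xeA => /(fsubsetP A'A).
    - suff <- : c (X n) (X n + std_basis i) (vac (A n)) =
                c (X n) (X n + std_basis i) (vac A') by [].
      apply: hr => [|z zr]; first exact: neighbors_basis.
      rewrite !vacE !inE; case: (z \in A n) => //=.
      by apply/esym/negbTE; rewrite negbK; apply/forallP.
  have AA' : A n = A'.
    apply/esym/eqP; rewrite eqEfcard A'A cA minN //.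
    by apply/asboolP; exists A'; split => //; exists (X n).
  apply/fsubsetP => u; rewrite in_translate opprK AA' !inE => /andP[_ /forallP uX].
  by apply: in_box => j; have := uX j; rewrite rvD addrK.
(* Pigeonhole: one more recentred cluster than there are subsets of the box. *)
pose s := [seq translate (- X n) (A n) | n <- iota 0 (#|` fpowerset (box r)|).+1].
have : ~~ uniq s.
  apply/negP => us.
  have : (size s <= size (fpowerset (box r)))%N.
    apply: uniq_leq_size us _ => S /mapP[n _ ->].
    by rewrite fpowersetE.
  by rewrite size_map size_iota ltnn.
case/(uniqPn fset0) => m [n [mn ns]].
rewrite size_map size_iota in ns.
rewrite !(nth_map 0%N) ?size_iota ?(ltn_trans mn ns) //.
rewrite !nth_iota ?(ltn_trans mn ns) // !add0n => e.
have {e} : A n = translate (X n - X m) (A m).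
  by rewrite translateD e -translateD subrr translate0.
set z := X n - X m => e.
have /esym e' := sA m (n - m)%N; rewrite subnK ?(ltnW mn) // in e'.
rewrite e sum_translate cA in e'; move/addrI : e' => e'.
have N0 : (0 < N)%N.
  rewrite -(cA 0%N) cardfs_gt0; apply/fset0Pn.
  by have [x /and3P[xA _ _]] := hA 0%N; exists x.
(* [N] times [z] equals [(n - m) e_i], hence [z] is a multiple of [e_i], and a positive one because
   [m < n]. *)
have zE : z = std_basis i *+ absz (z 0 i).
  apply/rowP => j; rewrite std_basisMnE.
  have /rowP/(_ j) := e'; rewrite std_basisMnE.
  rewrite (_ : (z *+ N) 0 j = z 0 j *+ N); last first.
    by elim: (N) => [|k IH]; rewrite ?mulr0n ?rv0 // !mulrS rvD IH.
  rewrite -mulr_natr natz; case: eqVneq => [<-|_]; move: (z 0 _) => q; nia.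
have k0 : (0 < absz (z 0%R i))%N.
  rewrite lt0n; apply/eqP => q0; move: e'; rewrite zE q0 mulr0n mul0rn.
  by move=> /rowP/(_ i); rewrite std_basisMnE eqxx rv0; lia.
exists (A m), (absz (z 0 i)); split=> //; first by rewrite cA.
  by rewrite -zE -e -(subnK (ltnW mn)).
by have [x /and3P[_ _ cx]] := hA m; exists x.
Qed.

End Gradient.

(** * Beads *)

Section Forms.
Variables (R : realType) (d : nat) (c : KCLG R d).
Notation T := 'rV[int]_d.
Implicit Types (x y z u v : T) (A B C E F : {fset T}) (i j : 'I_d).

Definition spread (I : finType) A (p : I -> T) : {fset T} :=
  \big[fsetU/fset0]_k translate (p k) A.

Lemma in_spread (I : finType) A (p : I -> T) x :
  reflect (exists2 k, exists2 a, a \in A & x = p k + a & True) (x \in spread A p).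
Proof.
apply: (iffP (in_bigU _ _)) => [[k]|[k [a aA ->] _]].
  by rewrite in_translate; exists k => //; exists (x - p k); rewrite // addrC subrK.
by exists k; rewrite in_translate addrC addKr.
Qed.

Lemma eq_spread (I : finType) A (p q : I -> T) : p =1 q -> spread A p = spread A q.
Proof. by move=> pq; apply: eq_bigr => k _; rewrite pq. Qed.

Lemma spread_translate (I : finType) A (p : I -> T) z :
  translate z (spread A p) = spread A (fun k => z + p k).
Proof.
apply/fsetP => x; rewrite in_translate; apply/in_spread/in_spread => -[k [a aA e] _].
  by exists k => //; exists a => //; rewrite -addrA -e addrC subrK.
by exists k => //; exists a => //; rewrite e -[z + p k + a]addrA [LHS]addrC addKr.
Qed.

(** The copies move one at a time. [Q k] says where other vacancies may be while copy [k] moves; the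
    second hypothesis grants it for the remaining copies both before and after their own moves. *)
Lemma spread_move (I : finType) (D : rel T) A (p p' : I -> T) (Q : I -> T -> Prop) E0 :
  (forall k E, (forall x, x \in E -> Q k x) ->
    hops c D (translate (p k) A `|` E) (translate (p' k) A `|` E)) ->
  (forall k l a, k != l -> a \in A -> Q k (p l + a) /\ Q k (p' l + a)) ->
  (forall k x, x \in E0 -> Q k x) ->
  hops c D (spread A p `|` E0) (spread A p' `|` E0).
Proof.
move=> mv sep QE.
pose q (s : seq I) k := if k \in s then p' k else p k.
have -> : spread A p' = spread A (q (enum I)).
  by apply: eq_spread => k; rewrite /q mem_enum.
elim: (enum I) => [|k s IH]; first exact: hops0.
apply: hops_trans IH _; case: (boolP (k \in s)) => ks.
  suff -> : spread A (q (k :: s)) = spread A (q s) by exact: hops0.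
  apply: eq_spread => l; rewrite /q inE; case: eqVneq => // ->.
  by rewrite ks.
rewrite /spread (bigD1 k) //= [X in hops _ _ _ (X `|` _)](bigD1 k) //=.
rewrite {1 3}/q inE eqxx (negPf ks) /= -!fsetUA.
have -> : \big[fsetU/fset0]_(l | l != k) translate (q (k :: s) l) A =
          \big[fsetU/fset0]_(l | l != k) translate (q s l) A.
  by apply: eq_bigr => l /negPf lk; rewrite /q inE lk.
apply: mv => x; rewrite in_fsetU => /orP[|/QE //].
case/bigfcupP => l /andP[_ lk]; rewrite in_translate => xA.
have [] := sep k l (x - q s l) _ xA; first by rewrite eq_sym.
rewrite /q; case: ifP => _ h1 h2.
  by move: h2; rewrite addrC subrK.
by move: h1; rewrite addrC subrK.
Qed.

Lemma cnt_bigU (I : finType) (P : pred T) (F : I -> {fset T}) :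
  (forall k l x, x \in F k -> x \in F l -> k = l) ->
  cnt P (\big[fsetU/fset0]_k F k) = (\sum_k cnt P (F k))%N.
Proof.
move=> dis; rewrite -!big_enum /=.
elim: (enum I) (enum_uniq I) => [|k s IH] /=.
  rewrite !big_nil => _; apply/eqP; rewrite cardfs_eq0; apply/eqP/fsetP => x.
  by rewrite !inE.
case/andP=> ks /IH {}IH; rewrite !big_cons -IH /cnt.
set S := \big[fsetU/fset0]_(_ <- _) _.
have -> : [fset a in F k `|` S | P a] = [fset a in F k | P a] `|` [fset a in S | P a].
  by apply/fsetP => x; rewrite !inE /= andb_orl.
rewrite cardfsU (_ : _ `&` _ = fset0) ?cardfs0 ?subn0 //.
apply/fsetP => x; rewrite !inE /=; apply/negP => /andP[/andP[xk _] /andP[xS _]].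
case/bigfcupP: xS => l /andP[ls _] xl.
by move: ks; rewrite (dis _ _ _ xk xl) ls.
Qed.

Lemma cnt_translate (P : pred T) z A :
  cnt P (translate z A) = cnt (fun a => P (z + a)) A.
Proof.
rewrite /cnt -(card_translate z [fset a in A | _]); congr #|` _|.
apply/fsetP => x; rewrite !inE !in_translate !inE /=.
by rewrite [z + (x - z)]addrC subrK.
Qed.

Lemma cnt_spread (I : finType) (P : pred T) A (p : I -> T) (D : nat) :
  (forall a, a \in A -> (l1 a <= D)%N) ->
  (forall k l, k != l -> (D + D < l1 (p k - p l))%N) ->
  cnt P (spread A p) = (\sum_k cnt (fun a => P (p k + a)%R) A)%N.
Proof.
move=> AD sep; rewrite cnt_bigU => [|k l x].
  by apply: eq_bigr => k _; rewrite cnt_translate.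
rewrite !in_translate => /AD xk /AD xl; case: (eqVneq k l) => // /sep.
have := l1B (x - p l) (x - p k); rewrite opprB addrC addrA subrK => h1 h2.
by exfalso; l1_lia.
Qed.

Lemma card_spread (I : finType) A (p : I -> T) (D : nat) :
  (forall a, a \in A -> (l1 a <= D)%N) ->
  (forall k l, k != l -> (D + D < l1 (p k - p l))%N) ->
  #|` spread A p| = (#|I| * #|` A|)%N.
Proof.
move=> AD sep; have := cnt_spread xpredT AD sep.
have cT B : cnt xpredT B = #|` B|.
  by congr #|` _|; apply/fsetP => x; rewrite !inE andbT.
rewrite cT => ->; under eq_bigr do rewrite cT.
by rewrite sum_nat_const.
Qed.

Lemma drift_mul i A (k m : nat) : drift c i A (translate (std_basis i *+ k) A) ->
  drift c i A (translate (std_basis i *+ (m * k)) A).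
Proof.
move=> dA; elim: m => [|m IH]; first by rewrite mul0n mulr0n translate0; exact: hops0.
apply: hops_trans IH _; rewrite mulSn mulrnDr addrC translateD.
exact: drift_translate.
Qed.

Definition mobile_bead i A (K rho : nat) := forall z E,
  (forall x, x \in E -> (rho < l1 (x - z))%N) ->
  drift c i (translate z A `|` E) (translate (z + std_basis i *+ K) A `|` E).

Lemma mobile_bead_exists i A (K : nat) : drift c i A (translate (std_basis i *+ K) A) ->
  exists rho, mobile_bead i A K rho.
Proof.
case/hops_local_translate => [z x y /eqP ->|rho mv]; first by rewrite addrA.
by exists rho => z E /mv; rewrite -translateD.
Qed.

Lemma mobile_bead_drift i A K rho : mobile_bead i A K rho ->
  drift c i A (translate (std_basis i *+ K) A).
Proof.
by move=> /(_ 0 fset0); rewrite add0r translate0 !fsetU0; apply => x; rewrite inE.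
Qed.

(** The gap keeps each copy, before and after its step, farther than [rho] from the starting point
    of any other. *)
Lemma spread_drift (I : finType) i A (K rho D : nat) (p : I -> T) :
  mobile_bead i A K rho -> (forall a, a \in A -> (l1 a <= D)%N) ->
  (forall k l, k != l -> (rho + D + K < l1 (p k - p l))%N) ->
  drift c i (spread A p) (spread A (fun k => p k + std_basis i *+ K)).
Proof.
move=> mv AD sep; rewrite -[spread A p]fsetU0 -[X in drift _ _ _ X]fsetU0.
apply: (spread_move (Q := fun k x => (rho < l1 (x - p k))%N)) => // [k E /mv //|k l a kl /AD aD].
have := sep l k; rewrite eq_sym kl => /(_ isT) lk.
have := l1B (p l + a - p k) a; rewrite addrAC addrK => h1.
split; first by l1_lia.
have := l1B (p l + std_basis i *+ K + a - p k) (a + std_basis i *+ K).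
have := l1D a (std_basis i *+ K); rewrite l1_basisn.
have -> : p l + std_basis i *+ K + a - p k - (a + std_basis i *+ K) = p l - p k.
  by row_ring.
by l1_lia.
Qed.

Lemma spread_drift_mul (I : finType) i A (K rho D m : nat) (p : I -> T) :
  mobile_bead i A K rho -> (forall a, a \in A -> (l1 a <= D)%N) ->
  (forall k l, k != l -> (rho + D + K < l1 (p k - p l))%N) ->
  drift c i (spread A p) (spread A (fun k => p k + std_basis i *+ (m * K))).
Proof.
move=> mv AD sep; elim: m => [|m IH].
  rewrite (_ : spread A (fun _ => _) = spread A p); first exact: hops0.
  by apply: eq_spread => k; rewrite mul0n mulr0n addr0.
apply: hops_trans IH _.
have -> : spread A (fun k => p k + std_basis i *+ (m.+1 * K)) =
    spread A (fun k => (p k + std_basis i *+ (m * K)) + std_basis i *+ K).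
  by apply: eq_spread => k; rewrite mulSnr mulrnDr addrA.
apply: spread_drift mv AD _ => k l /sep.
by rewrite opprD addrACA subrr addr0.
Qed.

Lemma mobile_bead_slide i A (K rho m : nat) z E : mobile_bead i A K rho ->
  (forall x n, x \in E -> (n < m)%N -> (rho < l1 (x - z - std_basis i *+ (n * K)))%N) ->
  drift c i (translate z A `|` E) (translate (z + std_basis i *+ (m * K)) A `|` E).
Proof.
move=> mv; elim: m => [|m IH] farE; first by rewrite mul0n mulr0n addr0; exact: hops0.
apply: hops_trans (IH _) _ => [x n xE nm|]; first by apply: farE; rewrite // ltnW.
rewrite mulSnr mulrnDr addrA; apply: mv => x xE.
by rewrite opprD addrA; apply: farE.
Qed.

(** The same [K] is the number of vacancies of a bead and its step, so that being swept by one full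
    bead amounts to a shift by one step. *)
Definition bead_family (A : 'I_d -> {fset T}) (K D rho : nat) :=
  [/\ (0 < K)%N, forall i, #|` A i| = K,
      forall i, mobile_bead i (A i) K rho,
      forall i a, a \in A i -> (l1 a <= D)%N
    & forall i, exists x, 1 <= c x (x + std_basis i) (vac (A i))].

(** Distant copies along the axis bring the number of vacancies up to [K], and repeated steps of
    length [k] make up one of length [K]. *)
Lemma bead_with_card i (K k : nat) A : drift c i A (translate (std_basis i *+ k) A) ->
  (0 < #|` A|)%N -> (0 < k)%N -> (0 < K)%N -> (exists x, 1 <= c x (x + std_basis i) (vac A)) ->
  (#|` A| %| K)%N -> (k %| K)%N ->
  exists B, [/\ #|` B| = K, drift c i B (translate (std_basis i *+ K) B)
     & exists x, 1 <= c x (x + std_basis i) (vac B)].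
Proof.
move=> dA A0 k0 K0 [x cx] /dvdnP[q Kq] /dvdnP[m Km].
have [rho mv] := mobile_bead_exists dA.
have [D AD] := fset_l1_bounded A.
pose G := (rho + D + D + k).+1.
pose p (j : 'I_q) := std_basis i *+ (G * j).
have sep s t : s != t -> (G <= l1 (p s - p t))%N.
  move=> st; rewrite /p !pmulrn -mulrzBr l1_basis.
  have : nat_of_ord s != nat_of_ord t by [].
  by move: (G) => g; nia.
exists (spread A p); split.
- rewrite (card_spread (D := D)) ?card_ord // => s t /sep; rewrite /G; l1_lia.
- rewrite spread_translate Km.
  have -> : spread A (fun s => std_basis i *+ (m * k) + p s) = spread A (fun s => p s + std_basis i *+ (m * k)).
    by apply: eq_spread => s; rewrite addrC.
  by apply: spread_drift_mul mv AD _ => s t /sep; rewrite /G; l1_lia.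
have q0 : (0 < q)%N by case: (q) Kq K0 => [->|].
exists x; apply: rate_mono cx; first exact: neighbors_basis.
apply/fsubsetP => a aA; apply/in_spread; exists (Ordinal q0) => //; exists a => //.
by rewrite /p muln0 mulr0n add0r.
Qed.

Lemma bead_family_exists : gradient c ->
  exists (A : 'I_d -> {fset T}) K D rho, bead_family A K D rho.
Proof.
move=> gc.
have /choice[A0 /choice[k hA]] i := drifting_cluster i gc.
(* A common multiple of the sizes and the steps of all clusters. *)
pose K := (\prod_i (#|` A0 i| * k i))%N.
have K0 : (0 < K)%N.
  by rewrite prodn_gt0 // => i; have [A1 k1 _ _] := hA i; rewrite muln_gt0 A1.
have dvdK i : (#|` A0 i| * k i %| K)%N by rewrite /K (bigD1 i) //= dvdn_mulr.
have /choice[A /= hB] i : exists B, [/\ #|` B| = K, drift c i B (translate (std_basis i *+ K) B)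
     & exists x, 1 <= c x (x + std_basis i) (vac B)].
  have [A1 k1 dA ux] := hA i; apply: bead_with_card dA A1 k1 K0 ux _ _.
    by apply: dvdn_trans (dvdK i); rewrite dvdn_mulr.
  by apply: dvdn_trans (dvdK i); rewrite dvdn_mull.
have /choice[D hD] i := fset_l1_bounded (A i).
have /choice[rho hrho] i : exists rho, mobile_bead i (A i) K rho.
  by have [_ dA _] := hB i; exact: mobile_bead_exists.
exists A, K, (\max_i D i), (\max_i rho i); split => // i.
- by have [] := hB i.
- move=> z E farE; apply: hrho => x /farE; apply: leq_ltn_trans.
  exact: leq_bigmax.
- by move=> a /hD /leq_trans; apply; exact: leq_bigmax.
- by have [] := hB i.
Qed.

End Forms.

(** * Mobile clusters and dimension one *)

Section Clusters.
Variables (R : realType) (d : nat) (c : KCLG R d).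
Notation T := 'rV[int]_d.
Implicit Types (x y z u v : T) (A B C E F : {fset T}) (i j : 'I_d).

(** The vectors by which [X] can be translated are closed under addition, and under negation by
    reversibility, so basis vectors suffice. Every edge is a translate of the usable edge in its
    direction. *)
Lemma mobile_clusterP X : X != fset0 ->
  (forall i, conn c X (translate (std_basis i) X)) ->
  (forall i, exists x, 1 <= c x (x + std_basis i) (vac X)) -> mobile_cluster c X.
Proof.
move=> X0 shiftX useX; split => //.
  suff cX : forall z, conn c X (translate z X).
    by move=> z; exact/conn_connected/cX.
  pose P z := conn c X (translate z X).
  have PD y z : P y -> P z -> P (y + z).
    move=> Py Pz; apply: hops_trans Py _; rewrite translateD.
    exact: conn_translate.
  have PN z : P z -> P (- z).
    move=> /(conn_translate (- z)); rewrite -translateD addNr translate0.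
    exact: conn_sym.
  have P0 : P 0 by rewrite /P translate0; exact: hops0.
  have Pn z n : P z -> P (z *+ n).
    by move=> Pz; elim: n => [|n IH]; rewrite ?mulr0n // mulrS; exact: PD.
  have Pm z (m : int) : P z -> P (z *~ m).
    move=> Pz; case: m => n; first exact: (Pn z n).
    by rewrite NegzE mulrNz; apply/PN/(Pn z n.+1).
  move=> z; rewrite -/(P z) (row_sum_delta z); elim/big_ind: _ => // i _.
  by rewrite -[z 0 i]intz scaler_int; apply: Pm; exact: shiftX.
move=> x y xy; have [i [e|e]] := neighborsP xy; have [u cu] := useX i.
  exists (x - u); rewrite e.
  have -> : x + std_basis i = (x - u) + (u + std_basis i) by rewrite addrA subrK.
  have {1}-> : x = (x - u) + u by rewrite subrK.
  by rewrite rate_translate // neighbors_basis.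
exists (y - u); rewrite rateC // e.
have -> : y + std_basis i = (y - u) + (u + std_basis i) by rewrite addrA subrK.
have {1}-> : y = (y - u) + u by rewrite subrK.
by rewrite rate_translate // neighbors_basis.
Qed.

(** Bead [s] sits at [s + K G s]. When bead 0 passes through all others, each of them is shifted
    back by [K], and bead [s + 1] takes the place of bead [s] in [X] translated by [H K + 1].
    Undoing a joint drift by [H K] leaves a net translation by 1. *)
Lemma noncooperative1 i (A : 'I_d -> {fset T}) K D rho :
  (forall j, j = i) -> bead_family c A K D rho -> noncooperative c.
Proof.
move=> one [K0 cardA mv AD useA].
have projE x y : proj i x = proj i y by apply/rowP => j; rewrite !mxE (one j) eqxx.
pose H := (rho + D + D + K).+1; pose G := H.+1.
pose p (s : 'I_K) := std_basis i *+ (s + K * G * s).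
have sep s t : s != t -> (rho + D + K < l1 (p s - p t))%N.
  move=> st; rewrite /p !pmulrn -mulrzBr l1_basis.
  have : nat_of_ord s != nat_of_ord t by [].
  have := leq_pmull G K0; rewrite {1}/G /H.
  move: (nat_of_ord s) (nat_of_ord t) (K * G)%N => m n q qG mn.
  have [lt|lt] : (m.+1 <= n)%N \/ (n.+1 <= m)%N by lia.
    by have := leq_mul (leqnn q) lt; rewrite mulnS; lia.
  by have := leq_mul (leqnn q) lt; rewrite mulnS; lia.
pose X := spread (A i) p; exists X.
have AX : A i `<=` X.
  apply/fsubsetP => a aA; apply/in_spread; exists (Ordinal K0) => //; exists a => //.
  by rewrite /p muln0 mulr0n add0r.
apply: mobile_clusterP.
- have : A i != fset0 by rewrite -cardfs_gt0 cardA.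
  case/fset0Pn => a /(fsubsetP AX) aX; apply/fset0Pn; by exists a.
- move=> j; rewrite (one j).
  have XH : conn c X (translate (std_basis i *+ (H * K)) X).
    apply: drift_conn; rewrite spread_translate.
    rewrite (_ : spread _ _ = spread (A i) (fun s => p s + std_basis i *+ (H * K))).
      exact: spread_drift_mul (mv i) (AD i) sep.
    by apply: eq_spread => s; rewrite addrC.
  apply: hops_trans (conn_sym (conn_translate (std_basis i) XH)).
  rewrite -translateD -mulrS.
  case: (K) K0 @p sep @X AX XH cardA mv => // K' _ p sep X AX XH cardA mv.
  (* [B] consists of the other beads after they have been passed. The passing bead ends as the last
     one, at [G K K]; the positions match because [G = H + 1]. *)
  pose B := spread (A i) (fun s : 'I_K' => std_basis i *+ (s.+1 + K'.+1 * G * s + K'.+1 * H)).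
  have -> : translate (std_basis i *+ (H * K'.+1).+1) X =
      translate (std_basis i *+ (G * K'.+1 * K'.+1)) (A i) `|` (B `|` fset0).
    rewrite fsetU0 spread_translate /spread big_ord_recr /= fsetUC; congr (_ `|` _).
      by rewrite /p /= -mulrnDr; congr (translate (_ *+ _) _); rewrite /= /G; lia.
    apply: eq_bigr => s _; congr (translate _ _); rewrite /p /= -mulrnDr.
    by congr (_ *+ _); lia.
  have -> : X = A i `|` (translate (std_basis i *+ K'.+1) B `|` fset0).
    rewrite fsetU0 /X /spread big_ord_recl /p /= muln0 addn0 mulr0n translate0.
    congr (_ `|` _); rewrite -/(spread _ _) spread_translate; apply: eq_spread => s.
    rewrite -mulrnDr; congr (_ *+ _); rewrite /bump /= add1n /G; lia.
  have coord a : a \in A i -> (`|a 0%R i| <= D)%N.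
    by move=> /AD; apply: leq_trans; exact: l1_coord.
  apply: (sweep (i := i) (n := K'.+1)) => //.
  + exact: drift_mul (mobile_bead_drift (mv i)).
  + move=> b _; rewrite -[RHS](cardA i); congr #|` _|; apply/fsetP => a.
    by rewrite !inE (projE a b) eqxx andbT.
  + move=> b a /in_spread[s [a' /coord h' ->] _] /coord h _.
    rewrite !rvE eqxx; move: h h'; rewrite /H.
    by move: (a 0 i) (a' 0 i) => m n; nia.
  + move=> b a /in_spread[s [a' /coord h' ->] _].
    rewrite in_translate => /coord; rewrite !rvE eqxx => h _.
    have sK := ltn_ord s; move: h h' sK; rewrite /G /H.
    by move: (a 0 i) (a' 0 i) (nat_of_ord s) => m n k; nia.
- move=> j; have [x cx] := useA j; exists x.
  apply: rate_mono cx; first exact: neighbors_basis.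
  by rewrite (one j).
Qed.

Lemma noncooperative0 : d = 0%N -> noncooperative c.
Proof.
move=> d0; exists [fset 0]; apply: mobile_clusterP.
- by apply/fset0Pn; exists 0; rewrite inE.
- by move=> i; have := ltn_ord i; rewrite {2}d0.
- by move=> i; have := ltn_ord i; rewrite {2}d0.
Qed.

End Clusters.

(** * Arms and vehicles *)

Section Arms.
Variables (R : realType) (d : nat) (c : KCLG R d).
Notation T := 'rV[int]_d.
Implicit Types (x y z u v : T) (B C E F : {fset T}) (i j : 'I_d).
Variables (A : 'I_d -> {fset T}) (K D rho : nat).
Hypothesis bead : bead_family c A K D rho.
(** [r] is the radius of an arm, [n] the number of steps that take a bead out of its tube, [rho1]
    the clearance from other vacancies, [g] the spacing of the beads along the axis, and [m * K] the
    distance of a resting arm from the origin. *)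
Variables (r n rho1 g' m : nat).
Notation g := (g' * K)%N.
Hypothesis r_large : (d.+2 * ((D + D + 2) * K) + D + D + K + K <= r)%N.
Hypothesis n_large : (3 * r + D + D < n)%N.
Hypothesis rho1_large : (rho + 3 * r + n * K + K + D < rho1)%N.
Hypothesis g_large : (rho1 + K + D + rho < g')%N.
Hypothesis m_large : (g * #|` @box d r| + D + D + r + r + K + K + rho1 < m)%N.

Let K0 : (0 < K)%N. Proof. by case: bead. Qed.
Let AD i a : a \in A i -> (l1 a <= D)%N. Proof. by case: bead => _ _ _ + _; apply. Qed.
Let cardA i : #|` A i| = K. Proof. by case: bead. Qed.
Let mv i : mobile_bead c i (A i) K rho. Proof. by case: bead. Qed.

Let AD_coord i j a : a \in A i -> (`|a 0%R j| <= D)%N.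
Proof. by move=> /AD; apply: leq_trans; exact: l1_coord. Qed.

Let gK : (g' <= g)%N. Proof. exact: leq_pmulr. Qed.
Let mK : (m <= m * K)%N. Proof. exact: leq_pmulr. Qed.

Lemma sweep_off i C C' F : drift c i C C' ->
  (forall f a, f \in F -> a \in C -> proj i a != proj i f) ->
  conn c (C `|` F) (C' `|` F).
Proof.
move=> CC' FC; have := @sweep R d c i C C' 1 fset0 F CC' isT.
have -> : translate (std_basis i *+ 1) fset0 = fset0.
  by apply/fsetP => x; rewrite in_translate !inE.
by rewrite !fset0U; apply.
Qed.

(** The transversal l1-ball, as a list because the index of a position also determines its place
    along the axis. *)
Definition window i : seq T := [seq w : T <- @box d r | (w 0 i == 0) && (l1 w <= r)%N].

Lemma mem_window i w : (w \in window i) = (w 0 i == 0) && (l1 w <= r)%N.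
Proof.
rewrite mem_filter andb_idr // => /andP[_ wr]; apply: in_box => j.
by have := leq_trans (l1_coord w j) wr; move: (w 0 j) => k; lia.
Qed.

Definition wsite i (k : 'I_(size (window i))) : T := nth 0 (window i) k.

(** One bead per transversal position, staggered along the axis so that the beads do not obstruct
    each other. *)
Definition slot i (k : 'I_(size (window i))) : T :=
  wsite k + std_basis i *+ (g * k).

(** [v] displaces the beads individually, as needed when an arm is moved bead by bead. *)
Definition arm i (v : 'I_(size (window i)) -> T) : {fset T} :=
  spread (A i) (fun k => slot k + v k).

Lemma windowP i (k : 'I_(size (window i))) :
  wsite k 0 i = 0 /\ (l1 (wsite k) <= r)%N.
Proof.
have := mem_nth (0 : T) (ltn_ord k); rewrite -/(wsite k) mem_window => /andP[/eqP ->].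
by [].
Qed.

Lemma size_window i (k : 'I_(size (window i))) : (g * k <= g * #|` @box d r|)%N.
Proof.
rewrite leq_mul2l ltnW ?orbT // (leq_trans (ltn_ord k)) //.
by rewrite size_filter count_size.
Qed.

Lemma arm_coord i (v : 'I_(size (window i)) -> T) x : x \in arm v -> exists k : 'I_(size (window i)),
  [/\ (`|(x 0 i - (g * k)%:Z - v k 0 i)%R| <= D)%N
    & forall j, j != i -> (`|x 0%R j| <= r + `|v k 0%R j| + D)%N].
Proof.
case/in_spread => k [a aA ->] _; exists k; have [w0 wr] := windowP k; split.
  rewrite /slot !rvE w0 eqxx; have := AD_coord i aA.
  by move: (a 0 i) (v k 0 i) => p q; lia.
move=> j /negPf ji; rewrite /slot !rvE eq_sym ji addr0.
have := leq_trans (l1_coord _ j) wr; have := AD_coord j aA.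
by move: (a 0 j) (v k 0 j) (wsite _ _ _) => p q s; lia.
Qed.

Lemma slot_sep i (k l : 'I_(size (window i))) u v : u 0 i = v 0 i -> k != l ->
  (g <= l1 (slot k + u - (slot l + v)))%N.
Proof.
move=> uv kl; apply: leq_trans (l1_coord _ i).
rewrite /slot !rvE eqxx (windowP k).1 (windowP l).1 uv.
have : nat_of_ord k != nat_of_ord l by [].
move: (nat_of_ord k) (nat_of_ord l) (g) (v 0 i) => p q s w pq.
have [lt|lt] : (p.+1 <= q)%N \/ (q.+1 <= p)%N by lia.
  by have := leq_mul (leqnn s) lt; rewrite mulnS; lia.
by have := leq_mul (leqnn s) lt; rewrite mulnS; lia.
Qed.

Lemma arm_drift i (v v' : 'I_(size (window i)) -> T) t :
  (forall k l, v k 0 i = v l 0 i) -> (forall k, v' k = v k + std_basis i *+ (t * K)) ->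
  drift c i (arm v) (arm v').
Proof.
move=> v0 v'E.
have -> : arm v' = spread (A i) (fun k => slot k + v k + std_basis i *+ (t * K)).
  by apply: eq_spread => k; rewrite v'E addrA.
apply: spread_drift_mul (mv i) (@AD i) _ => k l kl.
by apply: leq_trans (slot_sep (v0 k l) kl); lia.
Qed.

(** Each of the [K] vacancies [a] of the bead meets the line of [b] for exactly one transversal
    position [w a], and the bound on [b] puts this position in the window. *)
Lemma cnt_arm i u b : (l1 (proj i (b - u)%R) + D <= r)%N ->
  cnt (fun a => proj i a == proj i b) (arm (i := i) (fun=> u)) = K.
Proof.
move=> bu; rewrite -(cardA i).
pose w a := proj i (b - u) - proj i a.
have ww a : a \in A i -> w a \in window i.
  move=> aA; rewrite mem_window /w !rvE !mxE eqxx oppr0 addr0 eqxx /=.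
  apply: leq_trans (l1B _ _) _; apply: leq_trans bu; rewrite leq_add2l.
  by apply: leq_trans (AD aA); rewrite [X in (_ <= X)%N](l1_proj i) leq_addl.
pose f a := nth 0 (window i) (index (w a) (window i)) +
   std_basis i *+ (g * index (w a) (window i)) + u + a.
have fE a (aA : a \in A i) : exists k : 'I_(size (window i)),
    f a = slot k + u + a /\ wsite k = w a.
  have wi : (index (w a) (window i) < size (window i))%N by rewrite index_mem ww.
  by exists (Ordinal wi); rewrite /f /slot /wsite /= nth_index ?ww.
have finj : {in A i &, injective f}.
  move=> a a' aA a'A; have [k [-> _]] := fE a aA; have [l [-> _]] := fE a' a'A.
  case: (eqVneq k l) => [->|kl e]; first by move/addrI.
  have := slot_sep (erefl (u 0 i)) kl.
  have -> : slot k + u - (slot l + u) = a' - a.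
    by rewrite -[slot k + u](addrK a) e; row_ring.
  have := l1B a' a; have := AD aA; have := AD a'A => h1 h2 h3 h4.
  by exfalso; have := leq_trans h4 h3; lia.
rewrite /cnt; have -> : [fset a in arm (i := i) (fun=> u) | proj i a == proj i b] =
    [fset f a | a in A i].
  apply/fsetP => x; rewrite !inE /=; apply/andP/imfsetP => [[/in_spread[k [a aA ->] _]]|].
    rewrite !projD proj_basisn addr0 => /eqP e; exists a => //.
    have [w0 _] := windowP k.
    have pw : proj i (wsite k) = wsite k.
      by apply/rowP => j; rewrite mxE; case: eqP => // ->; rewrite w0.
    have wE : wsite k = w a.
      by rewrite -pw /w projD projN -e; row_ring.
    by rewrite /f -wE /wsite index_uniq // filter_uniq // fset_uniq.
  case=> a aA ->; have [k [-> wk]] := fE a aA; split.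
    by apply/in_spread; exists k => //; exists a.
  rewrite /slot wk /w !(projD, projN, proj_basisn).
  by apply/eqP/rowP => j; rewrite !mxE; case: eqP => // _; ring.
by rewrite card_in_imfset //= => a a' aA a'A; exact: finj.
Qed.

Definition home i : T := std_basis i *+ (m * K).

(* The arm [i] sweeps over the bead from one side to the other, the bead then
   leaves the tube of the arm, the arm sweeps back and the bead returns. *)
Lemma shift_bead0 i j z E : i != j -> (l1 z <= r + r)%N ->
  (l1 (proj i z) + D + D <= r)%N ->
  (forall x, x \in E -> exists2 k, k != i & (rho1 < `|x 0%R k|)%N) ->
  conn c (arm (i := i) (fun=> home i) `|` (translate z (A j) `|` E))
         (arm (i := i) (fun=> home i) `|` (translate (z + std_basis i *+ K) (A j) `|` E)).
Proof.
move=> ij zr pz farE.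
have ji : (j == i) = false by rewrite eq_sym; exact: negbTE.
pose back := - home i.
have home0 k : k != i -> home i 0 k = 0 by rewrite /home rvE eq_sym => /negPf ->.
have homei : home i 0 i = (m * K)%:Z by rewrite /home rvE eqxx.
have arm0 x t : t = home i \/ t = back -> x \in arm (i := i) (fun=> t) ->
    forall k, k != i -> (`|x 0%R k| <= r + D)%N.
  move=> th /in_spread[k [a aA ->] _] l li; have [_ wr] := windowP k.
  have t0 : t 0 l = 0 by case: th => ->; rewrite /back ?rvN home0 // oppr0.
  rewrite /slot !rvE eq_sym (negPf li) t0 !addr0.
  have := leq_trans (l1_coord _ l) wr; have := AD_coord l aA.
  by move: (a 0 l) (wsite _ _ _) => p s; lia.
have arm_far x : x \in arm (i := i) (fun=> home i) -> rho1%:Z + (r + r + K + D)%:Z < x 0 i.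
  case/arm_coord => k [+ _]; rewrite homei => h.
  by move: h m_large mK; move: (x 0 i) => p; lia.
have back_far x : x \in arm (i := i) (fun=> back) -> x 0 i < - (rho1%:Z + (r + r + K + D)%:Z).
  case/arm_coord => k [+ _]; rewrite /back rvN homei => h.
  by have := size_window k; move: h m_large mK; move: (x 0 i) (g * k)%N => p q; lia.
have off t F : t = home i \/ t = back ->
    (forall x, x \in F -> exists2 k, k != i & (r + D < `|x 0%R k|)%N) ->
    forall f a, f \in F -> a \in arm (i := i) (fun=> t) -> proj i a != proj i f.
  move=> th farF f a fF at_; apply/negP => /eqP/rowP e.
  have [k ki] := farF f fF; have := arm0 _ _ th at_ k ki.
  by have := e k; rewrite !mxE (negPf ki) => ->; rewrite leqNgt => /negP.
have bh : drift c i (arm (i := i) (fun=> back)) (arm (i := i) (fun=> home i)).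
  apply: (arm_drift (t := (m + m)%N)) => // _.
  by rewrite /back /home mulnDl mulrnDr addKr.
pose z' := z + std_basis i *+ K.
have zi : (`|z 0%R i| <= r + r)%N by exact: leq_trans (l1_coord _ _) zr.
have rr : (r + D < rho1)%N by lia.
have farE' : forall x, x \in E -> exists2 k, k != i & (r + D < `|x 0%R k|)%N.
  by move=> x /farE[k ki h]; exists k => //; lia.
have slideE F : (forall x, x \in F -> exists k, (rho1 < `|x 0%R k|)%N) ->
    conn c (translate z' (A j) `|` F) (translate (z' + std_basis j *+ (n * K)) (A j) `|` F).
  move=> farF; apply/drift_conn/mobile_bead_slide => // x t xF tn.
  have [k xk] := farF x xF; have := l1_coord x k.
  have := l1D (z' + std_basis j *+ (t * K)) (x - z' - std_basis j *+ (t * K)).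
  have -> : z' + std_basis j *+ (t * K) + (x - z' - std_basis j *+ (t * K)) = x by row_ring.
  have := l1D z' (std_basis j *+ (t * K)); have := l1D z (std_basis i *+ K).
  rewrite -/z' !l1_basisn.
  have : (t * K <= n * K)%N by rewrite leq_mul2r ltnW ?orbT.
  by move: xk rho1_large zr; l1_lia.
(* Sweeping from [back] to [home] takes the bead from [z'] to [z]; this is used in reverse. *)
have s1 : conn c (arm (i := i) (fun=> back) `|` (translate z' (A j) `|` E))
    (arm (i := i) (fun=> home i) `|` (translate z (A j) `|` E)).
  have -> : translate z' (A j) = translate (std_basis i *+ K) (translate z (A j)).
    by rewrite -translateD addrC.
  apply: (sweep (i := i)) => //.
  - move=> b; rewrite in_translate => bA; apply: cnt_arm.
    have -> : proj i (b - back) = proj i z + proj i (b - z).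
      by rewrite /back !(projD, projN) /home proj_basisn; row_ring.
    have := l1D (proj i z) (proj i (b - z)); have := l1_proj i (b - z); have := AD bA.
    by move: pz; move: (`|_|)%N => q; l1_lia.
  - move=> b a; rewrite in_translate => /(AD_coord i) + /back_far ha _; rewrite rvB => hb.
    by move: ha hb zi; move: (a 0 i) (b 0 i) (z 0 i) => p q s; lia.
  - move=> b a; rewrite in_translate => /(AD_coord i) + /arm_far ha _; rewrite rvB => hb.
    by move: ha hb zi; move: (a 0 i) (b 0 i) (z 0 i) => p q s; lia.
  - by apply: off => //; right.
apply: hops_trans (conn_sym s1) _.
rewrite fsetUCA; apply: hops_trans (slideE _ _) _.
  move=> x; rewrite in_fsetU => /orP[/back_far h|/farE[k _ h]]; last by exists k.
  by exists i; move: h; move: (x 0 i) => p; lia.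
rewrite fsetUCA.
(* Once the bead has left the tube, no line of the arm meets it, so the arm returns without moving
   it. *)
have s3 : conn c (arm (i := i) (fun=> back) `|` (translate (z' + std_basis j *+ (n * K)) (A j) `|` E))
  (arm (i := i) (fun=> home i) `|` (translate (z' + std_basis j *+ (n * K)) (A j) `|` E)).
  apply: (sweep_off bh); apply: off; first by right.
  move=> x; rewrite in_fsetU => /orP[|/farE' //]; rewrite in_translate.
  move=> /(AD_coord j); rewrite /z' !rvE eqxx eq_sym ji addr0 => h.
  exists j; rewrite ?ji //.
  have := leq_trans (l1_coord z j) zr; have := leq_pmulr n K0; move: h n_large.
  by move: (x 0 j) (z 0 j) => p q; lia.
apply: hops_trans s3 _; rewrite fsetUCA [X in hops _ _ _ X]fsetUCA.
apply/conn_sym/slideE => x; rewrite in_fsetU => /orP[/arm_far h|/farE[k _ h]]; last by exists k.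
by exists i; move: h; move: (x 0 i) => p; lia.
Qed.

(** Reduced by translation to an arm exactly at home; [u] accounts for an arm that has already taken
    its step. *)
Lemma shift_bead i j u z E : i != j -> (l1 z + l1 u <= r + r)%N ->
  (l1 (proj i z) + l1 u + D + D <= r)%N ->
  (forall x, x \in E -> exists2 k, k != i & (rho1 + l1 u < `|x 0%R k|)%N) ->
  conn c (arm (i := i) (fun=> u + home i) `|` (translate z (A j) `|` E))
         (arm (i := i) (fun=> u + home i) `|` (translate (z + std_basis i *+ K) (A j) `|` E)).
Proof.
move=> ij zr pz farE.
have armE : arm (i := i) (fun=> u + home i) = translate u (arm (i := i) (fun=> home i)).
  by rewrite spread_translate; apply: eq_spread => k; rewrite addrCA.
have EE : E = translate u (translate (- u) E) by rewrite -translateD subrr translate0.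
have zE v B : translate (z + v) B = translate u (translate ((z - u) + v) B).
  by rewrite -translateD; congr translate; row_ring.
rewrite armE EE zE -[z in translate z (A j)]addr0 zE addr0 -!translateU.
apply/conn_translate/shift_bead0 => //.
- by have := l1B z u; l1_lia.
- have := l1B (proj i z) (proj i u); rewrite -projN -projD.
  by have := l1_proj i u; move: (`|_|)%N => q; l1_lia.
move=> x; rewrite in_translate opprK => /farE[k ki h]; exists k => //.
by move: h; rewrite rvD; have := l1_coord u k; move: (x 0 k) (u 0 k) => p q; lia.
Qed.

(** * Transport of a bead by the arms of the other directions *)

Section Station.
Variables (j : 'I_d) (u : 'I_d -> T) (E0 : {fset T}).
Hypothesis uK : forall i, (l1 (u i) <= K)%N.
Hypothesis farE0 : forall x, x \in E0 -> (rho1 + K < `|x 0%R j|)%N.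

Definition others : {fset T} :=
  \big[fsetU/fset0]_(i | i != j) arm (i := i) (fun=> u i + home i).

(** A bead of direction [j] is transported while everything else is restored; [E0] will hold the
    remaining beads of its own arm. *)
Definition reach z z' :=
  conn c (translate z (A j) `|` (others `|` E0)) (translate z' (A j) `|` (others `|` E0)).

Lemma reach_sym z z' : reach z z' -> reach z' z.
Proof. exact: conn_sym. Qed.

Lemma reach_trans z' z z'' : reach z z' -> reach z' z'' -> reach z z''.
Proof. exact: hops_trans. Qed.

Lemma arm_home_coord i v x : (l1 v <= K)%N -> x \in arm (i := i) (fun=> v + home i) ->
  (rho1 + K < `|x 0%R i|)%N.
Proof.
move=> vK /arm_coord[k [+ _]]; rewrite /home rvD std_basisMnE eqxx.
have := leq_trans (l1_coord v i) vK; have := mK; move: m_large.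
by move: (x 0 i) (v 0 i) => p q; lia.
Qed.

(** Arm [i] does the work. The other arms are far out along their own axes and [E0] along axis [j],
    so they do not interfere. *)
Lemma reach1 i z : i != j -> (l1 z + K <= r + r)%N ->
  (l1 (proj i z) + K + D + D <= r)%N -> reach z (z + std_basis i *+ K).
Proof.
move=> ij zr pz; rewrite /reach /others (bigD1 i) //= -!fsetUA.
rewrite fsetUCA [X in conn _ _ X]fsetUCA.
apply: shift_bead => //.
- by have := uK i; l1_lia.
- by have := uK i; l1_lia.
move=> x; rewrite in_fsetU => /orP[/bigfcupP[k /andP[_ /andP[kj ki]] xk]|/farE0 h].
  exists k => //; have := arm_home_coord (uK k) xk; have := uK i.
  by move: (`|_|)%N => q; l1_lia.
exists j; first by rewrite eq_sym.
by move: h; have := uK i; move: (`|_|)%N => q; l1_lia.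
Qed.

Lemma reachn i z t : i != j -> (l1 z + t * K <= r + r)%N ->
  (l1 (proj i z) + K + D + D <= r)%N -> reach z (z + std_basis i *+ (t * K)).
Proof.
move=> ij; elim: t z => [|t IH] z zr pz; first by rewrite mul0n addr0; exact: hops0.
apply: reach_trans (IH _ _ _) _ => //; first by move: zr; rewrite mulSn; l1_lia.
rewrite mulSnr mulrnDr addrA; apply: reach1 => //.
  have := l1D z (std_basis i *+ (t * K)); rewrite l1_basisn.
  by move: zr; rewrite mulSn; l1_lia.
by rewrite projD proj_basisn addr0.
Qed.

Lemma reachz i z (t : int) : i != j -> (l1 z + `|t|%N * K + `|t|%N * K <= r + r)%N ->
  (l1 (proj i z) + K + D + D <= r)%N -> reach z (z + std_basis i *~ (t * K%:Z)).
Proof.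
move=> ij zr pz; case: t zr => t zr.
  by rewrite -PoszM -pmulrn; apply: reachn => //; move: zr => /=; l1_lia.
set z' := z + _; have -> : z = z' + std_basis i *+ (t.+1 * K).
  by rewrite /z' NegzE mulNr mulrNz -PoszM -pmulrn subrK.
apply/reach_sym/reachn => //; last by rewrite projD proj_basis addr0.
have := l1D z (std_basis i *~ (Negz t * K%:Z)); rewrite -/z' l1_basis abszM /=.
by move: zr; rewrite /=; l1_lia.
Qed.

(* If the bead is too far off the axis [i], some other coordinate [k] is large.
   Then the bead is near the axis [k], so the arm [k] can reduce that coordinate,
   which decreases the l1-norm enough for the arm [i] to act. *)
Lemma reach_basis i z : i != j -> z 0 j = 0 -> (l1 z <= r)%N ->
  reach z (z + std_basis i *+ K).
Proof.
move=> ij zj zr.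
have [near|far] := leqP (l1 (proj i z) + K + D + D) r.
  by apply: reach1 => //; move: r_large; l1_lia.
(* Lowering the norm by [L * K] provides the margin [D + D + K] required by [reach1] and room for
   one more step. *)
pose L := (D + D + 2)%N.
have LK : (D + D + K + K <= L * K)%N.
  by rewrite /L !mulnDl; have := leq_pmulr D K0; move: (D * K)%N => q; clear; lia.
have rl : (L * K + (L * K + d * (L * K)) + D + D + K + K <= r)%N by rewrite -!mulSn.
(* If all coordinates off axis [i] were below [L * K], the bead would be near that axis; the factor
   [d.+2] in [r_large] allows for this. *)
have [k ki kz] : exists2 k, k != i & (L * K <= `|z 0%R k|)%N.
  apply: contrapT => no; have : (l1 (proj i z) <= d * (L * K))%N.
    rewrite /l1 -[X in (_ <= X * _)%N]card_ord -sum_nat_const; apply: leq_sum => k _.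
    rewrite mxE; case: eqVneq => // ki; rewrite leqNgt; apply/negP => h.
    by apply: no; exists k => //; exact: ltnW.
  by move: far rl; move: (d * (L * K))%N (L * K)%N => w q; l1_lia.
have kj : k != j by apply: contraTneq kz => ->; rewrite zj; move: LK K0; move: (L * K)%N => q; clear; lia.
(* The sign moves coordinate [k] towards zero. *)
pose t : int := if 0 <= z 0 k then - L%:Z else L%:Z.
have tL : `|t|%N = L by rewrite /t; case: ifP => _; lia.
pose z' := z + std_basis k *~ (t * K%:Z).
have pz' : proj k z' = proj k z by rewrite projD proj_basis addr0.
have z'k : (`|z' 0%R k| + L * K = `|z 0%R k|)%N.
  rewrite /z' !rvE eqxx /t; move: kz; move: (z 0 k) => q.
  case: ifP => q0; rewrite ?mulNr -PoszM; move: (L * K)%N => w; lia.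
have z'r : (l1 z' + L * K <= r)%N.
  by rewrite (l1_proj k) pz'; move: zr z'k; rewrite (l1_proj k z);
    move: (`|z 0%R k|)%N (`|z' 0%R k|)%N => q q'; l1_lia.
have pk : (l1 (proj k z) + L * K <= r)%N.
  by move: zr kz; rewrite (l1_proj k z); move: (`|_|)%N => q; l1_lia.
have rL : (L * K + L * K + K + K <= r)%N.
  by move: rl; move: (d * (L * K))%N (L * K)%N => w q; clear; lia.
(* Inwards with arm [k], one step with arm [i], outwards again with arm [k]. *)
apply: (reach_trans (z' := z')).
  by apply: reachz => //; rewrite ?tL; move: rL LK; l1_lia.
apply: (reach_trans (z' := z' + std_basis i *+ K)).
  apply: reach1 => //; first by move: rL LK; l1_lia.
  have := l1_proj i z'; move: (`|_|)%N => p.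
  by move: rL LK z'r; l1_lia.
have -> : z' + std_basis i *+ K = (z + std_basis i *+ K) + std_basis k *~ (t * K%:Z).
  by rewrite /z' addrAC.
have zK := l1D z (std_basis i *+ K); rewrite l1_basisn in zK.
apply/reach_sym/reachz => //; rewrite ?tL.
  by move: rL LK zK zr; l1_lia.
have := l1D (proj k z) (proj k (std_basis i *+ K)); rewrite -projD.
have := l1_proj k (std_basis i *+ K); rewrite l1_basisn; move: (`|_|)%N => p.
by move: rL LK pk; l1_lia.
Qed.

End Station.

(** Any other arm [i] has coordinate [i] beyond [rho1 + K], while arm [j] stays within [r + K + D]
    there, so they share no line of direction [j]. *)
Lemma arm_slide j (u : 'I_d -> T) (v v' : 'I_(size (window j)) -> T) t :
  (forall i, (l1 (u i) <= K)%N) -> (forall k l, v k 0 j = v l 0 j) ->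
  (forall k i, i != j -> (`|v k 0%R i| <= K)%N) ->
  (forall k, v' k = v k + std_basis j *+ (t * K)) ->
  conn c (arm v `|` others j u) (arm v' `|` others j u).
Proof.
move=> uK v0 vK v'E; apply: sweep_off (arm_drift v0 v'E) _ => f a.
case/bigfcupP => i /andP[_ ij] /(arm_home_coord (uK i)) fi /arm_coord[k [_ /(_ i ij) ai]].
apply/negP => /eqP/rowP/(_ i); rewrite !mxE (negPf ij) => e.
move: fi; rewrite -e => fi; have := vK k i ij; move: fi ai rho1_large.
by move: (a 0 i) (v k 0 i) => p q; clear; lia.
Qed.

(* The whole arm slides along its axis until the bead [k0] is at the origin. *)
Lemma arm_move1 i j (u : 'I_d -> T) (v v' : 'I_(size (window j)) -> T) k0 :
  i != j -> (forall l, (l1 (u l) <= K)%N) ->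
  (forall k, v k = 0 \/ v k = std_basis i *+ K) -> v k0 = 0 ->
  (forall k, v' k = if k == k0 then std_basis i *+ K else v k) ->
  conn c (arm (fun k => v k + home j) `|` others j u)
         (arm (fun k => v' k + home j) `|` others j u).
Proof.
(* Subtracting [g * k0] along the axis puts bead [k0] into the hyperplane through the origin. *)
move=> ij uK v0 vk0 v'E; pose w (f : 'I_(size (window j)) -> T) k : T := f k - std_basis j *+ (g * k0).
have slide (v1 : 'I_(size (window j)) -> T) : (forall k, v1 k = 0 \/ v1 k = std_basis i *+ K) ->
    conn c (arm (w v1) `|` others j u) (arm (fun k => v1 k + home j) `|` others j u).
  move=> v10; apply: (arm_slide (t := (m + g' * k0)%N)) => // [k l|k l lj|k].
  - by rewrite /w !rvE; case: (v10 k) => ->; case: (v10 l) => ->;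
      rewrite ?rv0 ?std_basisMnE ?(negPf ij).
  - rewrite /w !rvE eq_sym (negPf lj) oppr0 addr0; case: (v10 k) => ->; rewrite ?rv0 //.
    by rewrite std_basisMnE; case: eqP.
  - by rewrite /w mulnDl mulrnDr /home (mulnAC g' k0 K); row_ring.
have v'0 k : v' k = 0 \/ v' k = std_basis i *+ K.
  by rewrite v'E; case: eqP => _; [right | exact: v0].
apply: hops_trans (conn_sym (slide v v0)) _; apply: hops_trans _ (slide v' v'0).
pose z := wsite k0; have [zj zr] := windowP k0.
(* The other beads of the arm are at least [g - D] away along axis [j], which exceeds [rho1 + K]. *)
pose E0 := \big[fsetU/fset0]_(k | k != k0) translate (slot k + w v k) (A j).
have armE (v1 : 'I_(size (window j)) -> T) : (forall k, k != k0 -> v1 k = v k) ->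
    arm (w v1) `|` others j u = translate (z + v1 k0) (A j) `|` (others j u `|` E0).
  move=> v1v; rewrite [others _ _ `|` E0]fsetUC fsetUA; congr (_ `|` _).
  rewrite /arm /spread (bigD1 k0) //=; congr (translate _ _ `|` _).
    by rewrite /slot /w -/z; row_ring.
  by apply: eq_bigr => k kk; rewrite /w v1v.
rewrite !armE //; last by move=> k /negPf kk; rewrite v'E kk.
rewrite v'E eqxx vk0 addr0; apply: reach_basis => // x /bigfcupP[k /andP[_ kk]].
rewrite in_translate => /(AD_coord j); rewrite /slot /w !rvE eqxx (windowP k).1.
have -> : v k 0 j = 0 by case: (v0 k) => ->; rewrite ?rv0 ?std_basisMnE ?(negPf ij).
have : nat_of_ord k != nat_of_ord k0 by [].
move: gK g_large; move: (x 0 j) (nat_of_ord k) (nat_of_ord k0) (g) => p s t q gq gl st.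
have [lt|lt] : (s.+1 <= t)%N \/ (t.+1 <= s)%N by lia.
  by have := leq_mul (leqnn q) lt; rewrite mulnS; move: gq gl; clear; lia.
by have := leq_mul (leqnn q) lt; rewrite mulnS; move: gq gl; clear; lia.
Qed.

(** Along its own axis the arm slides as a whole; in any other direction its beads are carried one
    by one. *)
Lemma arm_move i j (u : 'I_d -> T) : (forall l, (l1 (u l) <= K)%N) ->
  conn c (arm (i := j) (fun=> 0 + home j) `|` others j u)
         (arm (i := j) (fun=> std_basis i *+ K + home j) `|` others j u).
Proof.
move=> uK; case: (eqVneq i j) => [->|ij].
  apply: (arm_slide (t := 1%N)) => // [k l lj|k]; last by rewrite mul1n add0r addrC.
  by rewrite add0r /home std_basisMnE eq_sym (negPf lj).
pose v (s : seq 'I_(size (window j))) k := if k \in s then std_basis i *+ K else 0 : T.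
have -> : arm (i := j) (fun=> std_basis i *+ K + home j) =
    arm (fun k => v (enum 'I_(size (window j))) k + home j).
  by apply: eq_spread => k; rewrite /v mem_enum.
elim: (enum _) => [|k s IH]; first exact: hops0.
apply: hops_trans IH _; case: (boolP (k \in s)) => ks.
  rewrite (_ : arm (fun k' => v (k :: s) _ + _) = arm (fun k => v s k + home j)).
    exact: hops0.
  by apply: eq_spread => l; rewrite /v inE; case: eqVneq => // ->; rewrite ks.
apply: (arm_move1 (i := i) (k0 := k)) => // [l||l].
- by rewrite /v; case: ifP; [right | left].
- by rewrite /v (negPf ks).
- by rewrite /v inE; case: eqVneq.
Qed.

(** * Vehicles *)

Definition vehicle : {fset T} := \big[fsetU/fset0]_i arm (i := i) (fun=> home i).

(** The arms step one after another, each carried by the others whether or not these have stepped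
    already; [u s] records which have. *)
Lemma vehicle_shift i : conn c vehicle (translate (std_basis i *+ K) vehicle).
Proof.
pose u (s : seq 'I_d) j := if j \in s then std_basis i *+ K else 0 : T.
pose V s := \big[fsetU/fset0]_j arm (i := j) (fun=> u s j + home j).
have uK s j : (l1 (u s j) <= K)%N.
  rewrite /u; case: ifP => _; first by rewrite l1_basisn.
  by have := l1_basisn i 0; rewrite mulr0n => ->.
have -> : vehicle = V [::].
  by apply: eq_bigr => j _; apply: eq_spread => k; rewrite add0r.
have -> : translate (std_basis i *+ K) (V [::]) = V (enum 'I_d).
  apply/fsetP => x; rewrite in_translate; apply/in_bigU/in_bigU => -[j xj]; exists j.
    move: xj; rewrite -in_translate spread_translate; congr (_ \in _).
    by apply: eq_spread => k; rewrite /u mem_enum /= add0r addrCA.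
  rewrite -in_translate spread_translate; move: xj; congr (_ \in _).
  by apply: eq_spread => k; rewrite /u mem_enum /= add0r addrCA.
elim: (enum _) => [|j s IH]; first exact: hops0.
apply: hops_trans IH _; case: (boolP (j \in s)) => js.
  rewrite (_ : V (j :: s) = V s); first exact: hops0.
  apply: eq_bigr => l _; rewrite (_ : u (j :: s) l = u s l) // /u inE.
  by case: eqVneq => // ->; rewrite js.
rewrite /V (bigD1 j) //= [X in hops _ _ _ X](bigD1 j) //=.
have -> : \big[fsetU/fset0]_(l | l != j) arm (i := l) (fun=> u (j :: s) l + home l) =
    others j (u s).
  by apply: eq_bigr => l /negPf lj; apply: eq_spread => k; rewrite /u inE lj.
rewrite -/(others j (u s)) {1 3}/u inE eqxx (negPf js) /=.
exact: arm_move.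
Qed.

Lemma vehicle_usable i : exists x, 1 <= c x (x + std_basis i) (vac vehicle).
Proof.
have [x cx] : exists x, 1 <= c x (x + std_basis i) (vac (A i)) by case: bead.
have w0 : (0 : T) \in window i.
  by rewrite mem_window rv0 eqxx /= /l1 big1 // => j _; rewrite rv0.
have k0 : (0 < size (window i))%N by case: (window i) w0.
pose k := Ordinal k0; pose z := slot k + home i; exists (z + x).
rewrite -(addrA z x); apply: (@rate_mono R d c _ _ (translate z (A i))).
- by rewrite neighbors_translate neighbors_basis.
- apply/fsubsetP => y; rewrite in_translate => yz.
  by apply/in_bigU; exists i; apply/in_bigU; exists k; rewrite in_translate.
- by rewrite rate_translate // neighbors_basis.
Qed.

End Arms.

(** * Fleets *)

Section Fleet.
Variables (R : realType) (d : nat) (c : KCLG R d).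
Notation T := 'rV[int]_d.
Implicit Types (x y z u v : T) (A B C E F : {fset T}) (i j : 'I_d).

(** By non-degeneracy and monotonicity, all rates vanish in the full configuration. *)
Lemma usable_neq0 i (X : {fset T}) :
  (exists x, 1 <= c x (x + std_basis i) (vac X)) -> X != fset0.
Proof.
case=> x; apply: contraTneq => ->; rewrite -ltNge.
have nx := neighbors_basis x i; have [_ [eta e0]] := rate_nondegenerate c nx.
apply: le_lt_trans ltr01; rewrite -e0; apply: rate_decreasing => // z.
by rewrite vacE inE; case: (eta z).
Qed.

Variables (K : nat) (V : {fset T}).
Hypothesis K0 : (0 < K)%N.
Hypothesis V_shift : forall i, conn c V (translate (std_basis i *+ K) V).

Lemma lane_constants : exists N D : nat, (forall a, a \in V -> (l1 a <= D)%N) /\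
  forall i z E, (forall x, x \in E -> (N < l1 (x - z))%N) ->
    conn c (translate z V `|` E) (translate (z + std_basis i *+ K) V `|` E).
Proof.
have [D VD] := fset_l1_bounded V.
have /choice[N hN] i : exists n : nat, forall z E, (forall x, x \in E -> (n < l1 (x - z))%N) ->
    conn c (translate z V `|` E) (translate (z + std_basis i *+ K) V `|` E).
  have [//|n hn] := @hops_local_translate R d c (fun=> xpredT) _ _ _ (V_shift i).
  by exists n => z E /hn; rewrite translateD.
exists (\max_i N i), D; split=> // i z E farE; apply: hN => x /farE.
by apply: leq_ltn_trans; exact: leq_bigmax.
Qed.

(** Motion along [e_i] leaves coordinate [j] unchanged, and there the copies are far apart; each
    stays in its own lane and may travel any distance. *)
Lemma lane_move (I : finType) (N D : nat) i j (y : I -> T) (n : I -> nat) :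
  (forall a, a \in V -> (l1 a <= D)%N) ->
  (forall k z E, (forall x, x \in E -> (N < l1 (x - z))%N) ->
    conn c (translate z V `|` E) (translate (z + std_basis k *+ K) V `|` E)) ->
  i != j -> (forall g h, g != h -> (N + D < `|y g 0%R j - y h 0%R j|)%N) ->
  conn c (spread V y) (spread V (fun g => y g + std_basis i *+ (n g * K))).
Proof.
move=> VD mv ij sep; rewrite -[spread V y]fsetU0 -[X in conn _ _ X]fsetU0.
apply: (spread_move (Q := fun g x => (N < `|(x 0 j - y g 0 j)%R|)%N)) => // [g E farE|g h a gh /VD aD].
  elim: (n g) => [|t IH]; first by rewrite mul0n addr0; exact: hops0.
  apply: hops_trans IH _; rewrite mulSnr mulrnDr addrA; apply: mv => x /farE h.
  apply: leq_trans h (leq_trans _ (l1_coord _ j)).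
  by rewrite !rvE (negPf ij) addr0.
have := sep h g; rewrite eq_sym => /(_ gh); have := leq_trans (l1_coord a j) aD.
rewrite !rvE (negPf ij) addr0; move: (a 0 j) (y g 0 j) (y h 0 j) => p q s; clear.
by split; lia.
Qed.

Notation I := {ffun 'I_d -> 'I_K}.

Definition residue (f : I) : T := \row_j (f j : nat)%:Z.

(** The class that becomes class [f] under translation by [e_i]. *)
Definition pred_residue i (f : I) : I := [ffun j => if j == i then ord_pred (f j) else f j].

Lemma pred_residue_inj i : injective (pred_residue i).
Proof.
move=> f f' /ffunP e; apply/ffunP => j; have := e j; rewrite !ffunE.
by case: eqP => // _ /(can_inj (@ord_predK K)).
Qed.

(** A class that wraps around arrives one period [K] too far. *)
Lemma pred_residueE i f : std_basis i + residue (pred_residue i f) =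
  residue f + std_basis i *+ ((f i == 0%N :> nat) * K).
Proof.
apply/rowP => j; rewrite !rvE !mxE ffunE eq_sym.
case: eqVneq => [->|ij] /=; last by rewrite add0r addr0.
have := ltn_ord (f i); case: (nat_of_ord (f i)) => [|k] kK /=.
  by rewrite add0n modn_small ?prednK ?mul1n; lia.
by rewrite modnDr modn_small; lia.
Qed.

(** The fleet is a row along [e_i] in the order [code]. Its translate by [e_k] is such a row in
    another order, with the wrapped classes one step [K e_k] ahead; two dimensions suffice to
    rearrange one into the other. *)
Lemma fleet_mobile i j : i != j -> (forall k, exists x, 1 <= c x (x + std_basis k) (vac V)) ->
  noncooperative c.
Proof.
move=> ij useV; have [N [D [VD mv]]] := lane_constants.
pose G := (N + D).+3; pose code (f : I) : nat := enum_rank f.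
have code_inj : injective code by move=> f f' /ord_inj/enum_rank_inj.
(* For each class, [a], [b] and [e] count steps of length [K] along [e_i], [e_j] and [e_k]. *)
pose Y k (a b e : I -> nat) f := residue f + std_basis k *+ (e f * K) +
  std_basis i *+ (a f * K) + std_basis j *+ (b f * K).
pose none (_ : I) := 0%N.
(* Distinct multiples of [G * K] stay separated despite residues below [K] and one wrapping step. *)
have big_sep p q s t (w z : nat) : (p < K)%N -> (q < K)%N -> (s <= 1)%N -> (t <= 1)%N ->
    w != z -> (N + D < `|(p + s * K + w * G * K)%:Z - (q + t * K + z * G * K)%:Z|)%N.
  move=> pK qK s1 t1 wz.
  have KG : (N + D + K + K < G * K)%N by rewrite /G !mulSn; have := leq_pmulr (N + D) K0; lia.
  have sK : (s * K <= K)%N by rewrite -[X in (_ <= X)%N]mul1n leq_mul2r s1 orbT.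
  have tK : (t * K <= K)%N by rewrite -[X in (_ <= X)%N]mul1n leq_mul2r t1 orbT.
  rewrite -!mulnA; move: (G * K)%N (s * K)%N (t * K)%N KG sK tK => q0 s0 t0 KG sK tK.
  have [lt|lt] : (w.+1 <= z)%N \/ (z.+1 <= w)%N by lia.
    by have := leq_mul lt (leqnn q0); rewrite mulSn; move: KG sK tK pK qK; clear; lia.
  by have := leq_mul lt (leqnn q0); rewrite mulSn; move: KG sK tK pK qK; clear; lia.
have Yi k a b e f : Y k a b e f 0 i = (f i + (k == i) * e f * K + a f * K)%:Z.
  rewrite /Y !rvE mxE eqxx (eq_sym j i) (negPf ij) addr0.
  by case: (k == i); lia.
have Yj k a b e f : Y k a b e f 0 j = (f j + (k == j) * e f * K + b f * K)%:Z.
  rewrite /Y !rvE mxE eqxx (negPf ij) addr0.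
  by case: (k == j); lia.
have sepi k (h : I -> nat) b e : injective h -> (forall f, (e f <= 1)%N) -> forall f f', f != f' ->
    (N + D < `|(Y k (fun f => h f * G)%N b e f 0 i - Y k (fun f => h f * G)%N b e f' 0 i)%R|)%N.
  move=> hinj e1 f f' ff'; rewrite !Yi; apply: big_sep => //; last by rewrite (inj_eq hinj).
    by case: (k == i); rewrite ?mul1n.
  by case: (k == i); rewrite ?mul1n.
have sepj k (h : I -> nat) a e : injective h -> (forall f, (e f <= 1)%N) -> forall f f', f != f' ->
    (N + D < `|(Y k a (fun f => h f * G)%N e f 0 j - Y k a (fun f => h f * G)%N e f' 0 j)%R|)%N.
  move=> hinj e1 f f' ff'; rewrite !Yj; apply: big_sep => //; last by rewrite (inj_eq hinj).
    by case: (k == j); rewrite ?mul1n.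
  by case: (k == j); rewrite ?mul1n.
pose hG h (f : I) := (h f * G)%N.
have move_i k a b e h : injective h -> (forall f, (e f <= 1)%N) -> b = hG h ->
    conn c (spread V (Y k none b e)) (spread V (Y k a b e)).
  move=> hinj e1 ->.
  rewrite (@eq_spread d I V (Y k a (hG h) e) (fun f => Y k none (hG h) e f + std_basis i *+ (a f * K))).
    by apply: lane_move VD mv ij _; exact: sepj.
  by move=> f; rewrite /Y /none mul0n mulr0n; row_ring.
have move_j k a b e h : injective h -> (forall f, (e f <= 1)%N) -> a = hG h ->
    conn c (spread V (Y k a none e)) (spread V (Y k a b e)).
  move=> hinj e1 ->.
  rewrite (@eq_spread d I V (Y k (hG h) b e) (fun f => Y k (hG h) none e f + std_basis j *+ (b f * K))).
    by apply: lane_move VD mv _ _; [rewrite eq_sym | exact: sepi].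
  by move=> f; rewrite /Y /none mul0n mulr0n; row_ring.
have move_k k a b e h h' : injective h -> injective h' -> a = hG h -> b = hG h' ->
    conn c (spread V (Y k a b none)) (spread V (Y k a b e)).
  move=> hinj hinj' -> ->.
  rewrite (@eq_spread d I V (Y k (hG h) (hG h') e) (fun f => Y k (hG h) (hG h') none f + std_basis k *+ (e f * K))).
    case: (eqVneq k i) => [->|ki].
      by apply: lane_move VD mv ij _; exact: sepj.
    by apply: lane_move VD mv ki _; exact: sepi.
  by move=> f; rewrite /Y /none mul0n mulr0n; row_ring.
pose X := spread V (Y i (hG code) none none); exists X.
have f0 : I by exact: [ffun=> Ordinal K0].
have useX k : exists x, 1 <= c x (x + std_basis k) (vac X).
  have [x cx] := useV k; set z := Y i (hG code) none none f0.
  exists (z + x); rewrite -(addrA z x); apply: (@rate_mono R d c _ _ (translate z V)).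
  - by rewrite neighbors_translate neighbors_basis.
  - by apply/fsubsetP => y yz; apply/in_bigU; exists f0.
  - by rewrite rate_translate // neighbors_basis.
apply: mobile_clusterP (usable_neq0 (useX i)) _ useX => k.
pose code' := code \o pred_residue k.
have code'_inj : injective code' by exact: inj_comp code_inj (@pred_residue_inj k).
pose wrap (f : I) : nat := (f k == 0%N :> nat).
have wrap1 f : (wrap f <= 1)%N by rewrite /wrap; case: eqP.
have -> : X = spread V (Y k (hG code) none none).
  by apply: eq_spread => f; rewrite /Y /none !mul0n !mulr0n.
have -> : translate (std_basis k) (spread V (Y k (hG code) none none)) =
    spread V (Y k (hG code') none wrap).
  rewrite spread_translate /spread (reindex_inj (@pred_residue_inj k)).
  apply: eq_bigr => f _; congr (translate _ V).
  by rewrite /Y /none !mul0n !mulr0n !addr0 addrA pred_residueE.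
(* Spread out along [e_j], collapse along [e_i], line up in the new order, make the wrapping steps,
   collapse along [e_j]. At each stage a coordinate not in motion separates the vehicles. *)
apply: hops_trans (move_j k (hG code) (hG code) none code code_inj _ erefl) _ => //.
apply: hops_trans (conn_sym (move_i k (hG code) (hG code) none code code_inj _ erefl)) _ => //.
apply: hops_trans (move_i k (hG code') (hG code) none code code_inj _ erefl) _ => //.
apply: hops_trans (move_k k (hG code') (hG code) wrap code' code code'_inj code_inj erefl erefl) _.
exact: conn_sym (move_j k (hG code') (hG code) wrap code' code'_inj wrap1 erefl).
Qed.

End Fleet.

(** * From gradient models to mobile clusters *)

Lemma gradient_noncooperative (R : realType) d (c : KCLG R d) :
  gradient c -> noncooperative c.
Proof.
move=> /bead_family_exists[A [K [D [rho beadA]]]].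
case: (posnP d) => [|d0]; first exact: noncooperative0.
pose i := Ordinal d0; case: (pselect (exists j, i != j)) => [[j ij]|one]; last first.
  apply: (noncooperative1 (i := i)) beadA => j.
  by apply/eqP/negPn/negP => ji; apply: one; exists j; rewrite eq_sym.
have K0 : (0 < K)%N by case: beadA.
(* Each constant is the least value allowed by the hypotheses on arms, given the previous ones; [g]
   plays the role of [g']. *)
pose r := (d.+2 * ((D + D + 2) * K) + D + D + K + K)%N.
pose n := (3 * r + D + D).+1.
pose rho1 := (rho + 3 * r + n * K + K + D).+1.
pose g := (rho1 + K + D + rho).+1.
pose m := (g * K * #|` @box d r| + D + D + r + r + K + K + rho1).+1.
have shiftV := @vehicle_shift R d c A K D rho beadA r n rho1 g m
  (leqnn _) (leqnn _) (leqnn _) (leqnn _) (leqnn _).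
have useV := @vehicle_usable R d c A K D rho beadA r n rho1 g m
  (leqnn _) (leqnn _) (leqnn _) (leqnn _) (leqnn _).
exact (fleet_mobile K0 shiftV ij useV).
Qed.

Theorem theoremA4 (R : realType) (d : nat) (c : KCLG R d) :
  cooperative c -> nongradient c.
Proof. by move=> coop /gradient_noncooperative. Qed.
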